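(* Let $K$ be a field, let $H$ be a Hopf algebra over $K$ and let $E$ be a bialgebra over $K$. Let $\pi:E\to H$ be a surjective bialgebra homomorphism. Assume that $H$ is formally smooth as an algebra in $\mathfrak{M}_{K}$ and that the kernel $I$ of $\pi$ is a nilpotent ideal. Then $\pi$ has a section $\sigma:H\to E$ (i.e. $\pi\circ\sigma=\mathrm{Id}_H$) which is an algebra homomorphism in $\mathfrak{M}^{H}$, that is, a right $H$-colinear algebra homomorphism.
   Context: $\mathfrak{M}_K$ is the category of $K$-vector spaces and $\mathfrak{M}^H$ the monoidal category of right $H$-comodules (tensor product $\otimes_K$ with codiagonal coaction). $H$ is a right $H$-comodule via $\Delta_H$ and $E$ is a right $H$-comodule via $(E\otimes\pi)\Delta_E$. A $K$-algebra $A$ with multiplication $m:A\otimes_K A\to A$ is formally smooth as an algebra in $\mathfrak{M}_K$ if the $A$-bimodule $\Omega^1A=\ker m$ is projective relative to those $A$-bimodule morphisms that split as $K$-linear maps (since $K$ is a field, equivalently it is a projective $A$-bimodule). *)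

(* Defs.v *)
From HB Require Import structures.
From mathcomp Require Import all_boot all_order all_algebra.
From mathcomp Require Import boolp.

Set Implicit Arguments.
Unset Strict Implicit.
Unset Printing Implicit Defensive.

Import GRing.Theory.
Local Open Scope ring_scope.
Local Open Scope quotient_scope.

Reserved Notation "u \ox v" (at level 40, left associativity).

Notation bilinear_map f := (bilinear_for *:%R *:%R f).

(** An element of the tensor product of two K-vector spaces is represented by a
    finite formal sum of pairs (u, v).  Two formal sums are identified when no
    bilinear map tells them apart, i.e. when their difference lies in the kernel
    of the map from the free vector space on U * V onto the tensor product.
    The universal property is [tens_bilinear], [tensor_lift_linear] and
    [tensor_lift_tens] (existence), and [tensor_ext] (uniqueness). *)

Section TensorDef.
Variables (K : fieldType) (U V : lmodType K).

Definition formal_eval (W : lmodType K) (f : U -> V -> W) (s : seq (U * V)) : W :=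
  \sum_(p <- s) f p.1 p.2.

Definition tensor_rel : rel (seq (U * V)) := fun s t =>
  `[< forall (W : lmodType K) (f : U -> V -> W), bilinear_map f ->
      formal_eval f s = formal_eval f t >].

Lemma tensor_rel_refl : reflexive tensor_rel.
Proof. by move=> s; apply/asboolP. Qed.

Lemma tensor_rel_sym : symmetric tensor_rel.
Proof.
by move=> s t; apply/asboolP/asboolP => st W f bf; rewrite st.
Qed.

Lemma tensor_rel_trans : transitive tensor_rel.
Proof.
move=> t s r /asboolP st /asboolP tr; apply/asboolP => W f bf.
by rewrite st // tr.
Qed.

Canonical tensor_equiv :=
  EquivRel tensor_rel tensor_rel_refl tensor_rel_sym tensor_rel_trans.

Definition tensor : Type := {eq_quot tensor_equiv}.
HB.instance Definition _ := Choice.on tensor.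
HB.instance Definition _ := EqQuotient.on tensor.

Definition tens (u : U) (v : V) : tensor := \pi_tensor [:: (u, v)].

(** The linear map induced by a bilinear map f (a junk value when f is not
    bilinear). *)
Definition tensor_lift (W : lmodType K) (f : U -> V -> W) (t : tensor) : W :=
  formal_eval f (repr t).

Lemma tensor_lift_pi (W : lmodType K) (f : U -> V -> W) s :
  bilinear_map f -> tensor_lift f (\pi_tensor s) = formal_eval f s.
Proof.
move=> bf; rewrite /tensor_lift.
have /eqmodP/asboolP : repr (\pi_tensor s) = s %[mod tensor] by rewrite reprK.
exact.
Qed.

Lemma tensor_pi_eq s t :
  (forall (W : lmodType K) (f : U -> V -> W), bilinear_map f ->
     formal_eval f s = formal_eval f t) -> \pi_tensor s = \pi_tensor t.
Proof. by move=> st; apply/eqmodP/asboolP. Qed.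

Lemma tensor_eq (s t : tensor) :
  (forall (W : lmodType K) (f : U -> V -> W), bilinear_map f ->
     tensor_lift f s = tensor_lift f t) -> s = t.
Proof. by move=> st; rewrite -[s]reprK -[t]reprK; apply: tensor_pi_eq. Qed.

Definition scale_formal (a : K) (s : seq (U * V)) := [seq (a *: p.1, p.2) | p <- s].

Lemma formal_eval_cat (W : lmodType K) (f : U -> V -> W) s t :
  formal_eval f (s ++ t) = formal_eval f s + formal_eval f t.
Proof. exact: big_cat. Qed.

Lemma formal_eval_scale (W : lmodType K) (f : U -> V -> W) a s :
  bilinear_map f -> formal_eval f (scale_formal a s) = a *: formal_eval f s.
Proof.
move=> bf; rewrite /formal_eval big_map scaler_sumr; apply: eq_bigr => p _.
exact: (scalable_linear (bf.1 p.2)).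
Qed.

Definition tensor_zero : tensor := \pi_tensor [::].
Definition tensor_add (s t : tensor) : tensor := \pi_tensor (repr s ++ repr t).
Definition tensor_scale (a : K) (t : tensor) : tensor :=
  \pi_tensor (scale_formal a (repr t)).
Definition tensor_opp : tensor -> tensor := tensor_scale (-1).

Let lift0 (W : lmodType K) (f : U -> V -> W) :
  bilinear_map f -> tensor_lift f tensor_zero = 0.
Proof. by move=> bf; rewrite tensor_lift_pi // /formal_eval big_nil. Qed.

Let liftD (W : lmodType K) (f : U -> V -> W) s t : bilinear_map f ->
  tensor_lift f (tensor_add s t) = tensor_lift f s + tensor_lift f t.
Proof. by move=> bf; rewrite tensor_lift_pi // formal_eval_cat. Qed.

Let liftZ (W : lmodType K) (f : U -> V -> W) a t : bilinear_map f ->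
  tensor_lift f (tensor_scale a t) = a *: tensor_lift f t.
Proof. by move=> bf; rewrite tensor_lift_pi // formal_eval_scale. Qed.

Let addA : associative tensor_add.
Proof. by move=> r s t; apply: tensor_eq => W f bf; rewrite !liftD // addrA. Qed.

Let addC : commutative tensor_add.
Proof. by move=> s t; apply: tensor_eq => W f bf; rewrite !liftD // addrC. Qed.

Let add0 : left_id tensor_zero tensor_add.
Proof. by move=> t; apply: tensor_eq => W f bf; rewrite liftD // lift0 // add0r. Qed.

Let addN : left_inverse tensor_zero tensor_opp tensor_add.
Proof.
move=> t; apply: tensor_eq => W f bf.
by rewrite liftD // liftZ // lift0 // scaleN1r addNr.
Qed.

HB.instance Definition _ := GRing.isZmodule.Build tensor addA addC add0 addN.

Let scaleA a b t : tensor_scale a (tensor_scale b t) = tensor_scale (a * b) t.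
Proof. by apply: tensor_eq => W f bf; rewrite !liftZ // scalerA. Qed.

Let scale1 : left_id 1 tensor_scale.
Proof. by move=> t; apply: tensor_eq => W f bf; rewrite liftZ // scale1r. Qed.

Let scaleDr : right_distributive tensor_scale +%R.
Proof.
move=> a s t; apply: tensor_eq => W f bf.
by rewrite liftZ // !liftD // !liftZ // scalerDr.
Qed.

Let scaleDl t : {morph tensor_scale^~ t : a b / a + b}.
Proof.
move=> a b; apply: tensor_eq => W f bf.
by rewrite !liftD // !liftZ // scalerDl.
Qed.

HB.instance Definition _ :=
  GRing.Zmodule_isLmodule.Build K tensor scaleA scale1 scaleDr scaleDl.

Lemma tensor_lift_linear (W : lmodType K) (f : U -> V -> W) :
  bilinear_map f -> linear (tensor_lift f).
Proof. by move=> bf a s t; rewrite liftD // liftZ. Qed.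

Lemma tensor_lift_tens (W : lmodType K) (f : U -> V -> W) u v :
  bilinear_map f -> tensor_lift f (tens u v) = f u v.
Proof. by move=> bf; rewrite tensor_lift_pi // /formal_eval big_seq1. Qed.

Lemma tens_bilinear : bilinear_map tens.
Proof.
split=> [v a x y|u a x y]; apply: tensor_eq => W f bf;
  by rewrite (tensor_lift_linear bf) !tensor_lift_tens // ?(bf.1 v) ?(bf.2 u).
Qed.

Lemma tensor_ind (P : tensor -> Prop) :
  (forall u v, P (tens u v)) -> (forall s t, P s -> P t -> P (s + t)) ->
  forall t, P t.
Proof.
move=> Pt PD t; rewrite -[t]reprK; elim: (repr t) => [|[u v] s IHs].
  suff -> : \pi_tensor [::] = tens 0 0 by apply: Pt.
  by have /= := scalable_linear (tens_bilinear.1 0) 0 0; rewrite !scale0r => ->.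
suff -> : \pi_tensor ((u, v) :: s) = tens u v + \pi_tensor s by apply: PD.
apply: tensor_eq => W f bf.
by rewrite liftD // !tensor_lift_pi // /formal_eval big_cons big_seq1.
Qed.

Lemma tensor_ext (W : lmodType K) (f g : tensor -> W) :
  linear f -> linear g -> (forall u v, f (tens u v) = g (tens u v)) -> f =1 g.
Proof.
move=> lf lg fg; apply: tensor_ind => // s t fs ft.
by rewrite -[s]scale1r lf lg !scale1r fs ft.
Qed.

Lemma tensor_lift_linear_fun (W : lmodType K) (f g h : U -> V -> W) (a : K) t :
  (forall u v, f u v = a *: g u v + h u v) ->
  tensor_lift f t = a *: tensor_lift g t + tensor_lift h t.
Proof.
move=> fgh; rewrite /tensor_lift /formal_eval scaler_sumr -big_split.
exact: eq_bigr.
Qed.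

End TensorDef.

Arguments tens {K U V}.
Notation "u \ox v" := (tens u v) : ring_scope.

Lemma tens_linearl (K : fieldType) (U V : lmodType K) (v : V) :
  linear (fun u : U => u \ox v).
Proof. exact: (tens_bilinear U V).1. Qed.

Lemma tens_linearr (K : fieldType) (U V : lmodType K) (u : U) :
  linear (fun v : V => u \ox v).
Proof. exact: (tens_bilinear U V).2. Qed.

Section TensorMap.
Variables (K : fieldType) (U U' V V' : lmodType K).
Variables (f : {linear U -> U'}) (g : {linear V -> V'}).

Definition tensor_map : tensor U V -> tensor U' V' :=
  tensor_lift (fun u v => f u \ox g v).

Lemma tensor_map_bilinear : bilinear_map (fun u v => f u \ox g v).
Proof.
by split=> [v|u] a x y; rewrite linearP ?tens_linearl ?tens_linearr.
Qed.

Lemma tensor_map_tens u v : tensor_map (u \ox v) = f u \ox g v.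
Proof. exact: tensor_lift_tens tensor_map_bilinear. Qed.

HB.instance Definition _ := GRing.isLinear.Build K (tensor U V) (tensor U' V') _
  tensor_map (tensor_lift_linear tensor_map_bilinear).

End TensorMap.

Section TensorAssoc.
Variables (K : fieldType) (U V W : lmodType K).

Definition tensor_assoc : tensor (tensor U V) W -> tensor U (tensor V W) :=
  tensor_lift (fun t w => tensor_lift (fun u v => u \ox (v \ox w)) t).

Let inner_bilinear w :
  bilinear_map (fun (u : U) (v : V) => u \ox (v \ox w) : tensor U (tensor V W)).
Proof.
by split=> [v|u] a x y; rewrite ?tens_linearl ?tens_linearr.
Qed.

Let outer_bilinear : bilinear_map
  (fun t w => tensor_lift (fun (u : U) (v : V) =>
     u \ox (v \ox w) : tensor U (tensor V W)) t).
Proof.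
split=> [w|t] a x y; first exact: tensor_lift_linear.
by apply: tensor_lift_linear_fun => u v; rewrite !tens_linearr.
Qed.

Lemma tensor_assoc_tens u v w : tensor_assoc ((u \ox v) \ox w) = u \ox (v \ox w).
Proof. by rewrite /tensor_assoc !tensor_lift_tens. Qed.

HB.instance Definition _ := GRing.isLinear.Build K
  (tensor (tensor U V) W) (tensor U (tensor V W)) _
  tensor_assoc (tensor_lift_linear outer_bilinear).

End TensorAssoc.

Section TensorAlgebra.
Variables (K : fieldType) (A B : algType K).

Definition tensor_one : tensor A B := 1 \ox 1.

Definition tensor_mul (s t : tensor A B) : tensor A B :=
  tensor_lift (fun a b => tensor_lift (fun a' b' => (a * a') \ox (b * b')) t) s.

Let inner_bilinear (a : A) (b : B) :
  bilinear_map (fun (a' : A) (b' : B) => (a * a') \ox (b * b')).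
Proof.
by split=> [v|u] k x y; rewrite mulrDr -scalerAr ?tens_linearl ?tens_linearr.
Qed.

Let outer_bilinear (t : tensor A B) : bilinear_map
  (fun (a : A) (b : B) =>
     tensor_lift (fun (a' : A) (b' : B) => (a * a') \ox (b * b')) t).
Proof.
by split=> [v|u] k x y; apply: tensor_lift_linear_fun => a b;
  rewrite mulrDl -scalerAl ?tens_linearl ?tens_linearr.
Qed.

Lemma tensor_mul_tens a b a' b' :
  tensor_mul (a \ox b) (a' \ox b') = (a * a') \ox (b * b').
Proof. by rewrite /tensor_mul !tensor_lift_tens. Qed.

Lemma tensor_mul_linearl t : linear (tensor_mul^~ t).
Proof. exact: tensor_lift_linear. Qed.

Lemma tensor_mul_linearr s : linear (tensor_mul s).
Proof.
move=> k x y; apply: tensor_lift_linear_fun => a b.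
exact: tensor_lift_linear.
Qed.

Let mulDl : left_distributive tensor_mul +%R.
Proof. by move=> x y t; rewrite -[x]scale1r tensor_mul_linearl !scale1r. Qed.

Let mulDr : right_distributive tensor_mul +%R.
Proof. by move=> s x y; rewrite -[x]scale1r tensor_mul_linearr !scale1r. Qed.

Let mulA : associative tensor_mul.
Proof.
move=> r s t.
elim/tensor_ind: r => [a b|r r' IHr IHr']; last by rewrite !mulDl IHr IHr'.
elim/tensor_ind: s => [a' b'|s s' IHs IHs']; last first.
  by rewrite mulDl !mulDr mulDl IHs IHs'.
elim/tensor_ind: t => [a'' b''|t t' IHt IHt']; last by rewrite !mulDr IHt IHt'.
by rewrite !tensor_mul_tens !mulrA.
Qed.

Let mul1 : left_id tensor_one tensor_mul.
Proof.
elim/tensor_ind => [a b|s t IHs IHt]; last by rewrite mulDr IHs IHt.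
by rewrite tensor_mul_tens !mul1r.
Qed.

Let mulr1 : right_id tensor_one tensor_mul.
Proof.
elim/tensor_ind => [a b|s t IHs IHt]; last by rewrite mulDl IHs IHt.
by rewrite tensor_mul_tens !mulr1.
Qed.

HB.instance Definition _ :=
  GRing.Zmodule_isPzRing.Build (tensor A B) mulA mul1 mulr1 mulDl mulDr.

End TensorAlgebra.

Section Multiplication.
Variables (K : fieldType) (A : algType K).

Definition mult : tensor A A -> A := tensor_lift (fun a b => a * b).

Lemma mult_bilinear : bilinear_map (fun a b : A => a * b).
Proof.
by split=> [v|u] k x y; rewrite ?mulrDl ?mulrDr -?scalerAl -?scalerAr.
Qed.

Lemma mult_tens a b : mult (a \ox b) = a * b.
Proof. exact: tensor_lift_tens mult_bilinear. Qed.

HB.instance Definition _ := GRing.isLinear.Build K (tensor A A) A _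
  mult (tensor_lift_linear mult_bilinear).

End Multiplication.

HB.mixin Record Lmodule_isCoalgebra (K : fieldType) C of GRing.Lmodule K C := {
  comul : {linear C -> tensor C C};
  counit : {linear C -> K^o};
  coassoc : forall c : C,
    tensor_assoc (tensor_map comul idfun (comul c)) =
    tensor_map idfun comul (comul c);
  counitl : forall c : C,
    tensor_lift (fun x y => (counit x : K) *: y) (comul c) = c;
  counitr : forall c : C,
    tensor_lift (fun x y => (counit y : K) *: x) (comul c) = c
}.

#[short(type="coalgType")]
HB.structure Definition Coalgebra (K : fieldType) :=
  {C of GRing.Lmodule K C & Lmodule_isCoalgebra K C}.

HB.mixin Record AlgCoalg_isBialgebra (K : fieldType) B
    of GRing.Algebra K B & Coalgebra K B := {
  comul1 : comul (1 : B) = 1;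
  comulM : {morph (@comul K B) : x y / x * y};
  counit1 : counit (1 : B) = 1;
  counitM : {morph (@counit K B) : x y / x * y}
}.

#[short(type="bialgType")]
HB.structure Definition Bialgebra (K : fieldType) :=
  {B of GRing.Algebra K B & Coalgebra K B & AlgCoalg_isBialgebra K B}.

HB.mixin Record Bialgebra_isHopf (K : fieldType) H of Bialgebra K H := {
  antipode : {linear H -> H};
  antipodel : forall h : H,
    mult (tensor_map antipode idfun (comul h)) = (counit h : K)%:A;
  antipoder : forall h : H,
    mult (tensor_map idfun antipode (comul h)) = (counit h : K)%:A
}.

#[short(type="hopfType")]
HB.structure Definition Hopf (K : fieldType) :=
  {H of Bialgebra K H & Bialgebra_isHopf K H}.

Definition coalgebra_hom (K : fieldType) (C D : coalgType K)
    (f : {linear C -> D}) : Prop :=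
  (forall c, comul (f c) = tensor_map f f (comul c)) /\
  (forall c, counit (f c) = counit c).

Definition bialgebra_hom (K : fieldType) (B B' : bialgType K)
    (f : {lrmorphism B -> B'}) : Prop := coalgebra_hom f.

Definition colinear (K : fieldType) (C : coalgType K) (V W : lmodType K)
    (rhoV : V -> tensor V C) (rhoW : W -> tensor W C)
    (f : {linear V -> W}) : Prop :=
  forall v, rhoW (f v) = tensor_map f idfun (rhoV v).

Section LinearKernel.
Variables (K : fieldType) (U V : lmodType K) (f : {linear U -> V}).

Definition lin_ker : {pred U} := [pred u | f u == 0].

Lemma lin_ker_submod : submod_closed lin_ker.
Proof.
split=> [|a x y]; rewrite !inE ?linear0 // => /eqP fx /eqP fy.
by rewrite linearP fx fy scaler0 addr0.
Qed.

HB.instance Definition _ :=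
  GRing.isSubmodClosed.Build K U lin_ker lin_ker_submod.

End LinearKernel.

(** For an ideal I, the power I^n is spanned by the n-fold products of elements
    of I. *)
Definition nilpotent_ideal (R : pzRingType) (I : {pred R}) : Prop :=
  exists n : nat, forall x : 'I_n -> R,
    (forall i, x i \in I) -> \prod_(i < n) x i = 0.

(** The left and right actions of A induce the same action of K, namely the
    given one. *)
HB.mixin Record Lmodule_isBimodule (K : fieldType) (A : algType K) M
    of GRing.Lmodule K M := {
  lact : A -> M -> M;
  ract : M -> A -> M;
  lact_bilinear : bilinear_map lact;
  ract_bilinear : bilinear_map ract;
  lact1 : forall m, lact 1 m = m;
  ract1 : forall m, ract m 1 = m;
  lactM : forall a b m, lact (a * b) m = lact a (lact b m);
  ractM : forall a b m, ract m (a * b) = ract (ract m a) b;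
  lractA : forall a b m, ract (lact a m) b = lact a (ract m b)
}.

#[short(type="bimodType")]
HB.structure Definition Bimodule (K : fieldType) (A : algType K) :=
  {M of GRing.Lmodule K M & Lmodule_isBimodule K A M}.

Definition bimodule_hom (K : fieldType) (A : algType K) (M N : bimodType A)
    (f : {linear M -> N}) : Prop :=
  (forall (a : A) (m : M), f (lact a m) = lact a (f m)) /\
  (forall (a : A) (m : M), f (ract m a) = ract (f m) a).

Section TensorBimodule.
Variables (K : fieldType) (A : algType K).

Definition tensor_lact (a : A) (t : tensor A A) : tensor A A := (a \ox 1) * t.
Definition tensor_ract (t : tensor A A) (a : A) : tensor A A := t * (1 \ox a).

Lemma tensor_lact_tens a x y : tensor_lact a (x \ox y) = (a * x) \ox y.
Proof. by rewrite /tensor_lact [LHS]tensor_mul_tens mul1r. Qed.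

Lemma tensor_ract_tens a x y : tensor_ract (x \ox y) a = x \ox (y * a).
Proof. by rewrite /tensor_ract [LHS]tensor_mul_tens mulr1. Qed.

Let lact_bilinear : bilinear_map tensor_lact.
Proof.
split=> [t|a] k x y; last exact: tensor_mul_linearr.
by rewrite /tensor_lact tens_linearl; apply: tensor_mul_linearl.
Qed.

Let ract_bilinear : bilinear_map tensor_ract.
Proof.
split=> [a|t] k x y; first exact: tensor_mul_linearl.
by rewrite /tensor_ract tens_linearr; apply: tensor_mul_linearr.
Qed.

Let lact1 t : tensor_lact 1 t = t. Proof. exact: mul1r. Qed.

Let ract1 t : tensor_ract t 1 = t. Proof. exact: mulr1. Qed.

Let lactM a b t : tensor_lact (a * b) t = tensor_lact a (tensor_lact b t).
Proof.
rewrite /tensor_lact mulrA; congr (_ * _).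
by rewrite [RHS]tensor_mul_tens mulr1.
Qed.

Let ractM a b t : tensor_ract t (a * b) = tensor_ract (tensor_ract t a) b.
Proof.
rewrite /tensor_ract -mulrA; congr (_ * _).
by rewrite [RHS]tensor_mul_tens mulr1.
Qed.

Let lractA a b t : tensor_ract (tensor_lact a t) b = tensor_lact a (tensor_ract t b).
Proof. exact/esym/mulrA. Qed.

HB.instance Definition _ := Lmodule_isBimodule.Build K A (tensor A A)
  lact_bilinear ract_bilinear lact1 ract1 lactM ractM lractA.

Lemma mult_lact a t : mult (tensor_lact a t) = a * mult t.
Proof.
elim/tensor_ind: t => [x y|s t IHs IHt].
  by rewrite tensor_lact_tens !mult_tens mulrA.
by rewrite /tensor_lact mulrDr !linearD /= mulrDr IHs IHt.
Qed.

Lemma mult_ract a t : mult (tensor_ract t a) = mult t * a.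
Proof.
elim/tensor_ind: t => [x y|s t IHs IHt].
  by rewrite tensor_ract_tens !mult_tens mulrA.
by rewrite /tensor_ract mulrDl !linearD /= mulrDl IHs IHt.
Qed.

End TensorBimodule.

Section Omega1.
Variables (K : fieldType) (A : algType K).

Definition Omega1 : Type := {t : tensor A A | t \in lin_ker (@mult K A)}.

HB.instance Definition _ := SubChoice.on Omega1.
HB.instance Definition _ := [SubChoice_isSubLmodule of Omega1 by <:].

Let lact_ker (a : A) (w : Omega1) :
  (lact a (val w : tensor A A)) \in lin_ker (@mult K A).
Proof. by rewrite inE /= mult_lact (eqP (valP w)) mulr0. Qed.

Let ract_ker (w : Omega1) (a : A) :
  (ract (val w : tensor A A) a) \in lin_ker (@mult K A).
Proof. by rewrite inE /= mult_ract (eqP (valP w)) mul0r. Qed.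

Definition Omega1_lact (a : A) (w : Omega1) : Omega1 :=
  exist (fun t => t \in lin_ker (@mult K A)) _ (lact_ker a w).
Definition Omega1_ract (w : Omega1) (a : A) : Omega1 :=
  exist (fun t => t \in lin_ker (@mult K A)) _ (ract_ker w a).

Let lact_bil : bilinear_map Omega1_lact.
Proof.
split=> [w|a] k x y; apply: val_inj.
  exact: (lact_bilinear.1 (val w)).
exact: (lact_bilinear.2 a).
Qed.

Let ract_bil : bilinear_map Omega1_ract.
Proof.
split=> [a|w] k x y; apply: val_inj.
  exact: (ract_bilinear.1 a).
exact: (ract_bilinear.2 (val w)).
Qed.

Let lact_1 w : Omega1_lact 1 w = w.
Proof. by apply: val_inj; apply: lact1. Qed.

Let ract_1 w : Omega1_ract w 1 = w.
Proof. by apply: val_inj; apply: ract1. Qed.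

Let lact_M a b w : Omega1_lact (a * b) w = Omega1_lact a (Omega1_lact b w).
Proof. by apply: val_inj; apply: lactM. Qed.

Let ract_M a b w : Omega1_ract w (a * b) = Omega1_ract (Omega1_ract w a) b.
Proof. by apply: val_inj; apply: ractM. Qed.

Let lract_A a b w :
  Omega1_ract (Omega1_lact a w) b = Omega1_lact a (Omega1_ract w b).
Proof. by apply: val_inj; apply: lractA. Qed.

HB.instance Definition _ := Lmodule_isBimodule.Build K A Omega1
  lact_bil ract_bil lact_1 ract_1 lact_M ract_M lract_A.

End Omega1.

Definition rel_projective (K : fieldType) (A : algType K) (P : bimodType A) :
    Prop :=
  forall (M N : bimodType A) (p : {linear M -> N}) (f : {linear P -> N}),
    bimodule_hom p -> (exists s : {linear N -> M}, cancel s p) ->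
    bimodule_hom f ->
    exists g : {linear P -> M}, bimodule_hom g /\ (forall x, p (g x) = f x).

Definition formally_smooth (K : fieldType) (A : algType K) : Prop :=
  rel_projective (Omega1 A : bimodType A).

(* Main.v *)
Require Import Defs.
From HB Require Import structures.
From mathcomp Require Import all_boot all_order all_algebra.
From mathcomp Require Import boolp classical_sets.

Set Implicit Arguments.
Unset Strict Implicit.
Unset Printing Implicit Defensive.

Import GRing.Theory.
Local Open Scope ring_scope.

(** Write I = ker pi, rho = (E (x) pi) Delta_E for the coaction of H on E and S
    for the antipode of H.  Two corrections, each squaring the error it removes,
    are alternated until they become exact by nilpotency of I.

    Multiplicativity.  A linear f : H -> E with f 1 = 1 whose defect
    c(h, k) = f h f k - f (h k) lies in I^r is a Newton approximation to an
    algebra map: formal smoothness splits the bimodule epimorphism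
    H (x) H (x) H -> Omega^1 H, which yields a derivation
    d : H -> H (x) H (x) H, and with d h = sum a (x) b (x) e the map
    h |-> f h + sum c(a, b) f e agrees with f modulo I^r and has its defect in I^2r.

    Colinearity.  Let s : H -> E be an algebra section whose defect
    D = rho s - (s (x) H) Delta takes values in I^r (x) H.  Put
    theta e = e_0 s(S e_1) and h |-> theta(s h_1) s h_2.  This map agrees with s
    modulo I^r.  It is multiplicative modulo I^2r because
    theta(e e') = e_0 theta(e') s(S e_1), and colinear modulo I^2r because
    rho(theta e) and theta e (x) 1 are obtained from the same formula,
    rho(e_0) g(S e_1), for the two algebra maps g = rho s and
    g = (s (x) H) Delta, which differ by D. *)

(** * Linear and bilinear expressions *)

Section LinearMaps.
Variables (K : fieldType) (U V W : lmodType K).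

Lemma linear_id : linear (fun x : U => x).
Proof. by []. Qed.

Lemma linear_comp (L : {linear V -> W}) (f : U -> V) :
  linear f -> linear (fun x => L (f x)).
Proof. by move=> lf a x y; rewrite lf linearP. Qed.

Lemma linear_add (f g : U -> V) :
  linear f -> linear g -> linear (fun x => f x + g x).
Proof. by move=> lf lg a x y; rewrite lf lg scalerDr addrACA. Qed.

Lemma linear_opp (f : U -> V) : linear f -> linear (fun x => - f x).
Proof. by move=> lf a x y; rewrite lf opprD scalerN. Qed.

Lemma linear_scaler (k : K) (f : U -> V) :
  linear f -> linear (fun x => k *: f x).
Proof. by move=> lf a x y; rewrite lf scalerDr !scalerA mulrC. Qed.

Lemma linear_scalel (f : U -> K^o) (v : V) :
  linear f -> linear (fun x => (f x : K) *: v).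
Proof. by move=> lf a x y; rewrite lf scalerDl -scalerA. Qed.

Lemma linear_tensl (f : U -> V) (w : W) :
  linear f -> linear (fun x => f x \ox w).
Proof. by move=> lf a x y; rewrite lf tens_linearl. Qed.

Lemma linear_tensr (f : U -> V) (w : W) :
  linear f -> linear (fun x => w \ox f x).
Proof. by move=> lf a x y; rewrite lf tens_linearr. Qed.

End LinearMaps.

Section LinearMul.
Variables (K : fieldType) (U : lmodType K) (A B : algType K).

Lemma linear_mull (f : U -> A) c : linear f -> linear (fun x => f x * c).
Proof. by move=> lf a x y; rewrite lf mulrDl scalerAl. Qed.

Lemma linear_mulr (f : U -> A) c : linear f -> linear (fun x => c * f x).
Proof. by move=> lf a x y; rewrite lf mulrDr scalerAr. Qed.

Lemma linear_tmull (f : U -> tensor A B) c :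
  linear f -> linear (fun x => f x * c).
Proof. by move=> lf a x y; rewrite lf; apply: tensor_mul_linearl. Qed.

Lemma linear_tmulr (f : U -> tensor A B) c :
  linear f -> linear (fun x => c * f x).
Proof. by move=> lf a x y; rewrite lf; apply: tensor_mul_linearr. Qed.

End LinearMul.

Section LinearLift.
Variables (K : fieldType) (U V X W : lmodType K).

Lemma linear_lift_fun (b : X -> U -> V -> W) t :
  (forall u v, linear (fun x => b x u v)) ->
  linear (fun x => tensor_lift (b x) t).
Proof. by move=> lb a x y; apply: tensor_lift_linear_fun => u v; apply: lb. Qed.

Lemma linear_lift_arg (b : U -> V -> W) (f : X -> tensor U V) :
  bilinear_map b -> linear f -> linear (fun x => tensor_lift b (f x)).
Proof. by move=> bb lf a x y; rewrite lf (tensor_lift_linear bb). Qed.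

End LinearLift.

(** Linearity is proved by following the shape of the expression; composition with a bundled linear
    map is tried last, after the more specific shapes. *)
Ltac lin := repeat first
  [ solve [auto] | exact: linear_id | exact: linearP | apply: tensor_lift_linear
  | match goal with |- bilinear_for _ _ _ => split => ? /= end
  | match goal with |- forall _, _ => move=> ? /= end
  | apply: linear_lift_arg | apply: linear_lift_fun
  | apply: linear_tensl | apply: linear_tensr
  | apply: linear_add | apply: linear_opp
  | apply: linear_scaler | apply: linear_scalel
  | apply: linear_mull | apply: linear_mulr
  | apply: linear_tmull | apply: linear_tmulr
  | apply: linear_comp ].

(** * Sweedler calculus *)

Section TensorLift.
Variables (K : fieldType) (U V W : lmodType K).
Implicit Types (b : U -> V -> W) (t : tensor U V).

(** [tensor_lift b t] is a finite sum over the chosen representative of [t], so this and the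
    following rules are rules for finite sums. *)
Lemma eq_lift b b' t :
  (forall u v, b u v = b' u v) -> tensor_lift b t = tensor_lift b' t.
Proof. by move=> bb'; apply: eq_bigr => p _. Qed.

Lemma lift_linear (W' : lmodType K) (f : W -> W') b t : linear f ->
  f (tensor_lift b t) = tensor_lift (fun u v => f (b u v)) t.
Proof.
move=> lf; rewrite /tensor_lift /formal_eval.
have fD x y : f (x + y) = f x + f y by rewrite -[x]scale1r lf !scale1r.
have f0 : f 0 = 0 by have := scalable_linear lf 0 0; rewrite /= !scale0r.
by elim: (repr t) => [|p s IHs]; rewrite ?big_nil // !big_cons fD IHs.
Qed.

Lemma lift_add b b' t :
  tensor_lift (fun u v => b u v + b' u v) t =
  tensor_lift b t + tensor_lift b' t.
Proof. exact: big_split. Qed.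

Lemma lift_opp b t : tensor_lift (fun u v => - b u v) t = - tensor_lift b t.
Proof. by rewrite /tensor_lift /formal_eval sumrN. Qed.

Lemma lift_swap (X Y : lmodType K) (b : U -> V -> X -> Y -> W) t s :
  tensor_lift (fun u v => tensor_lift (b u v) s) t =
  tensor_lift (fun x y => tensor_lift (fun u v => b u v x y) t) s.
Proof. exact: exchange_big. Qed.

End TensorLift.

Section TensorLiftMap.
Variables (K : fieldType) (U V W : lmodType K).

Lemma lift_map (X Y : lmodType K) (f : {linear X -> U}) (g : {linear Y -> V})
    (b : U -> V -> W) (t : tensor X Y) : bilinear_map b ->
  tensor_lift b (tensor_map f g t) = tensor_lift (fun x y => b (f x) (g y)) t.
Proof.
move=> bb; rewrite /tensor_map (lift_linear (f := tensor_lift b));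
  last exact: tensor_lift_linear.
by apply: eq_lift => x y; rewrite tensor_lift_tens.
Qed.

Lemma tensor_liftE (t : tensor U V) : tensor_lift tens t = t.
Proof.
elim/tensor_ind: t => [u v|s t IHs IHt].
  by rewrite tensor_lift_tens //; lin.
rewrite -[s]scale1r (tensor_lift_linear (tens_bilinear U V)) scale1r.
by rewrite scale1r IHs IHt.
Qed.

End TensorLiftMap.

Lemma lift_mul (K : fieldType) (A B : algType K) (W : lmodType K)
    (b : A -> B -> W) (s t : tensor A B) : bilinear_map b ->
  tensor_lift b (s * t) =
  tensor_lift (fun x y => tensor_lift (fun x' y' => b (x * x') (y * y')) t) s.
Proof.
move=> bb; rewrite [s * t]/(tensor_mul s t) /tensor_mul.
rewrite (lift_linear (f := tensor_lift b)); last exact: tensor_lift_linear.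
apply: eq_lift => x y.
rewrite (lift_linear (f := tensor_lift b)); last exact: tensor_lift_linear.
by apply: eq_lift => x' y'; rewrite tensor_lift_tens.
Qed.

Lemma tens_mul (K : fieldType) (A B : algType K) (a a' : A) (b b' : B) :
  (a \ox b) * (a' \ox b') = (a * a') \ox (b * b').
Proof. exact: tensor_mul_tens. Qed.

Section Sweedler.
Variables (K : fieldType) (C : coalgType K) (W : lmodType K).

(** Both bracketings of the sum of t(c_1, c_2, c_3) are values of the map [T3] induced by [t] on the
    triple tensor product, taken at the two sides of [coassoc]. *)
Lemma sweedler_assoc (t : C -> C -> C -> W) (c : C) :
  (forall y, bilinear_map (fun u v => t u v y)) ->
  (forall u, bilinear_map (t u)) ->
  tensor_lift (fun x y => tensor_lift (fun u v => t u v y) (comul x))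
    (comul c) =
  tensor_lift (fun x y => tensor_lift (t x) (comul y)) (comul c).
Proof.
move=> t12 t23.
have t1 u v : linear (fun x => t x u v) by case: (t12 v).
have t2 u v : linear (fun x => t u x v) by case: (t12 v).
have t3 u v : linear (fun x => t u v x) by case: (t23 u).
pose T3 := tensor_lift (fun x s => tensor_lift (t x) s).
have bT3 : bilinear_map (fun x s => tensor_lift (t x) s) by lin.
rewrite -(lift_map comul idfun
  (b := fun s y => tensor_lift (fun u v => t u v y) s)); last by lin.
rewrite -(lift_map idfun comul (b := fun x s => tensor_lift (t x) s)) //.
rewrite -coassoc; move: (tensor_map comul idfun (comul c)).
apply: tensor_ext.
- by apply: tensor_lift_linear; lin.
- by apply: linear_lift_arg => //; apply: linear_comp; lin.
move=> s y; rewrite tensor_lift_tens; last by lin.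
elim/tensor_ind: s => [u v|s s' IHs IHs'].
  by rewrite tensor_assoc_tens !tensor_lift_tens.
rewrite -[s]scale1r tens_linearl linearP.
by rewrite !(tensor_lift_linear bT3) (tensor_lift_linear (t12 y)) IHs IHs'.
Qed.

Lemma sweedler_counitl (f : C -> W) (c : C) : linear f ->
  tensor_lift (fun x y => (counit x : K) *: f y) (comul c) = f c.
Proof.
move=> lf; rewrite -[in RHS](counitl c) lift_linear //; apply: eq_lift => x y.
exact/esym/(scalable_linear lf).
Qed.

Lemma sweedler_counitr (f : C -> W) (c : C) : linear f ->
  tensor_lift (fun x y => (counit y : K) *: f x) (comul c) = f c.
Proof.
move=> lf; rewrite -[in RHS](counitr c) lift_linear //; apply: eq_lift => x y.
exact/esym/(scalable_linear lf).
Qed.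

End Sweedler.

Lemma sweedler_hom (K : fieldType) (C D : coalgType K) (W : lmodType K)
    (f : {linear C -> D}) (b : D -> D -> W) c :
  coalgebra_hom f -> bilinear_map b ->
  tensor_lift b (comul (f c)) =
  tensor_lift (fun x y => b (f x) (f y)) (comul c).
Proof. by case=> -> _ bb; rewrite lift_map. Qed.

(** * Convolution and the antipode *)

Section Antipode.
Variables (K : fieldType) (H : hopfType K).

Lemma sweedler_antipodel (W : lmodType K) (f : H -> W) h : linear f ->
  tensor_lift (fun x y => f (antipode x * y)) (comul h) = (counit h : K) *: f 1.
Proof.
move=> lf; rewrite -(scalable_linear lf) -antipodel /mult lift_map.
  by rewrite lift_linear.
exact: mult_bilinear.
Qed.

Lemma sweedler_antipoder (W : lmodType K) (f : H -> W) h : linear f ->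
  tensor_lift (fun x y => f (x * antipode y)) (comul h) = (counit h : K) *: f 1.
Proof.
move=> lf; rewrite -(scalable_linear lf) -antipoder /mult lift_map.
  by rewrite lift_linear.
exact: mult_bilinear.
Qed.

(** Convolution is associative and S is a right inverse of the identity, so convolving [a] with the
    identity and then with S gives [a] back. *)
Lemma convolution_idK (a : H -> H) h : linear a ->
  tensor_lift (fun x y =>
    tensor_lift (fun u v => a u * v) (comul x) * antipode y) (comul h) = a h.
Proof.
move=> la.
transitivity (tensor_lift (fun x y =>
    tensor_lift (fun u v => a u * v * antipode y) (comul x)) (comul h)).
  apply: eq_lift => x y.
  rewrite (lift_linear (f := fun z => z * antipode y)) //.
  by lin.
rewrite (sweedler_assoc (t := fun u v y => a u * v * antipode y)); try by lin.
rewrite -[RHS]sweedler_counitr //; apply: eq_lift => x y.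
rewrite -[in RHS](mulr1 (a x)).
rewrite -(sweedler_antipoder (f := fun z => a x * z)); last by lin.
by apply: eq_lift => u v; rewrite mulrA.
Qed.

Lemma convolution_id_inj (a b : H -> H) : linear a -> linear b ->
  (forall h, tensor_lift (fun u v => a u * v) (comul h) =
             tensor_lift (fun u v => b u * v) (comul h)) -> a =1 b.
Proof.
move=> la lb ab h; rewrite -(convolution_idK h la) -(convolution_idK h lb).
by apply: eq_lift => x y; rewrite ab.
Qed.

(** Convolution with the identity is cancelled in one variable at a time: in h, both sides become
    eps(h) S(k); in k, what is left becomes eps(h) eps(k) 1 on both sides. *)
Lemma antipodeM (h k : H) : antipode (h * k) = antipode k * antipode h.
Proof.
move: h; apply: convolution_id_inj; try by lin.
move=> h; transitivity ((counit h : K) *: antipode k); last first.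
  rewrite -[X in _ *: X]mulr1.
  rewrite -(sweedler_antipodel (f := fun z => antipode k * z)); last by lin.
  by apply: eq_lift => x y; rewrite mulrA.
move: k; apply: convolution_id_inj; try by lin.
move=> k; transitivity ((counit h * counit k : K) *: (1 : H)).
  rewrite -[X in X *: _](counitM h k).
  rewrite -(sweedler_antipodel (f := fun x => x)) // comulM.
  rewrite lift_mul; last by lin.
  rewrite lift_swap; apply: eq_lift => p q.
  rewrite (lift_linear (f := fun z => z * q)); last by lin.
  by apply: eq_lift => u v; rewrite mulrA.
rewrite -scalerA -(sweedler_antipodel (f := fun x => x)) //.
rewrite (lift_linear (f := fun z => (counit h : K) *: z)); last by lin.
by apply: eq_lift => x y; rewrite scalerAl.
Qed.

Lemma antipode1 : antipode (1 : H) = 1.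
Proof.
have := antipodel (1 : H).
rewrite comul1 /= tensor_map_tens mult_tens mulr1 => ->.
by rewrite (counit1 : counit (1 : H) = 1) scale1r.
Qed.

End Antipode.

(** * Powers of ideals *)

Section IdealPowers.
Variables (K : fieldType) (A : algType K).

Record twosided (I : A -> Prop) : Prop := Twosided {
  twosided0 : I 0;
  twosidedD : forall x y, I x -> I y -> I (x + y);
  twosidedMl : forall a x, I x -> I (a * x);
  twosidedMr : forall a x, I x -> I (x * a)
}.

Lemma twosidedZ I k x : twosided I -> I x -> I (k *: x).
Proof. by move=> idI Ix; rewrite -mulr_algl; apply: twosidedMl. Qed.

Lemma twosidedN I x : twosided I -> I x -> I (- x).
Proof. by move=> idI Ix; rewrite -scaleN1r; apply: twosidedZ. Qed.

Lemma twosidedB I x y : twosided I -> I x -> I y -> I (x - y).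
Proof. by move=> idI Ix Iy; apply: twosidedD => //; apply: twosidedN. Qed.

Lemma twosided_lift (I : A -> Prop) (U V : lmodType K) (b : U -> V -> A) t :
  twosided I -> (forall u v, I (b u v)) -> I (tensor_lift b t).
Proof.
move=> idI Ib; rewrite /tensor_lift /formal_eval.
by elim/big_ind: _ => [|x y|p _] //; [apply: twosided0|apply: twosidedD].
Qed.

(** An additive span of right-nested products, with I^0 the whole algebra; the last factor of a
    product is thus an arbitrary element. Closure under scalars comes out of
    [ideal_power_twosided]. *)
Inductive ideal_power (I : A -> Prop) : nat -> A -> Prop :=
| ideal_power0 x : ideal_power I 0 x
| ideal_powerM r x y : I x -> ideal_power I r y -> ideal_power I r.+1 (x * y)
| ideal_powerD r x y :
    ideal_power I r x -> ideal_power I r y -> ideal_power I r (x + y).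

Variables (I : A -> Prop) (idI : twosided I).

Lemma ideal_power_twosided r : twosided (ideal_power I r).
Proof.
split=> [|x y||].
- case: r => [|r]; first exact: ideal_power0.
  elim: r => [|r IHr]; rewrite -(mul0r 0); apply: ideal_powerM => //;
    by [apply: twosided0 | apply: ideal_power0].
- exact: ideal_powerD.
- move=> a x; elim=> [{}x|{}r {}x y Ix Iy _|{}r {}x y _ IHx _ IHy].
  + exact: ideal_power0.
  + by rewrite mulrA; apply: ideal_powerM => //; apply: twosidedMl.
  + by rewrite mulrDr; apply: ideal_powerD.
move=> a x; elim=> [{}x|{}r {}x y Ix _ IHy|{}r {}x y _ IHx _ IHy].
+ exact: ideal_power0.
+ by rewrite -mulrA; apply: ideal_powerM.
+ by rewrite mulrDl; apply: ideal_powerD.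
Qed.

Lemma ideal_power_mul r s x y :
  ideal_power I r x -> ideal_power I s y -> ideal_power I (r + s) (x * y).
Proof.
move=> Ix Iy; elim: Ix => {r x} [x|r x z Ix _ IHz|r x z _ IHx _ IHz].
- exact: (twosidedMl (ideal_power_twosided s)).
- by rewrite -mulrA addSn; apply: ideal_powerM.
- by rewrite mulrDl; apply: ideal_powerD.
Qed.

Lemma ideal_power_leq r s x :
  (r <= s)%N -> ideal_power I s x -> ideal_power I r x.
Proof.
move=> rs Ix; elim: Ix r rs => {s x} [x|s x y Ix _ IHy|s x y _ IHx _ IHy] r rs.
- by move: rs; rewrite leqn0 => /eqP->; apply: ideal_power0.
- case: r rs => [|r] rs; first exact: ideal_power0.
  by apply: ideal_powerM => //; apply: IHy.
- by apply: ideal_powerD; [apply: IHx | apply: IHy].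
Qed.

Lemma ideal_power1 x : I x -> ideal_power I 1 x.
Proof.
by move=> Ix; rewrite -[x]mulr1; apply: ideal_powerM => //; constructor.
Qed.

Lemma ideal_power_sub r x : (0 < r)%N -> ideal_power I r x -> I x.
Proof.
move=> r0 Ix; elim: Ix r0 => {r x} // [r x y Ix _ _ _|r x y _ IHx _ IHy r0].
  exact: twosidedMr.
by apply: twosidedD; [|apply: IHx|apply: IHy].
Qed.

Lemma ideal_power_nilpotent n r x :
  (forall x : 'I_n -> A, (forall i, I (x i)) -> \prod_(i < n) x i = 0) ->
  (n <= r)%N -> ideal_power I r x -> x = 0.
Proof.
move=> nilI nr /(ideal_power_leq nr).
have nil_seq (s : seq A) : size s = n -> (forall y, y \in s -> I y) ->
    \prod_(y <- s) y = 0.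
  move=> sn Is; rewrite (big_nth 0) sn big_mkord.
  by apply: nilI => i; apply/Is/mem_nth; rewrite sn.
(* Generalised for the induction: [s] stores the factors already peeled off, and its length plus the
   remaining exponent stays equal to n. At exponent 0 the list alone is an n-fold product. *)
suff prod0 (s : seq A) r' : (size s + r' = n)%N -> (forall y, y \in s -> I y) ->
    ideal_power I r' x -> \prod_(y <- s) y * x = 0.
  by move=> /(prod0 [::]) <- //; rewrite big_nil mul1r.
move=> sn Is Ix; elim: Ix s sn Is => {r' x}
  [x|r' x y Ix _ IHy|r' x y _ IHx _ IHy] s sn Is.
- by rewrite nil_seq ?mul0r // -sn addn0.
- have := IHy (rcons s x); rewrite -cats1 big_cat big_seq1 mulrA /=; apply.
    by rewrite size_cat /= -addnA.
  by move=> z; rewrite mem_cat mem_seq1 => /orP[/Is//|/eqP->].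
- by rewrite mulrDr IHx // IHy // addr0.
Qed.

End IdealPowers.

(** * Tensors whose left factors lie in an ideal *)

Section TensorSpan.
Variables (K : fieldType) (A B : algType K).

(* I (x) B, as a span inside A (x) B: no exactness of (x) is needed. *)
Inductive tensor_span (I : A -> Prop) : tensor A B -> Prop :=
| tensor_span_tens a b : I a -> tensor_span I (a \ox b)
| tensor_spanD s t :
    tensor_span I s -> tensor_span I t -> tensor_span I (s + t).

Lemma tensor_span_lift (W : lmodType K) (P : W -> Prop) (I : A -> Prop)
    (f : tensor A B -> W) t :
  linear f -> (forall x y, P x -> P y -> P (x + y)) ->
  (forall a b, I a -> P (f (a \ox b))) -> tensor_span I t -> P (f t).
Proof.
move=> lf PD Pf; elim=> [a b|s s' _ Ps _ Ps']; first exact: Pf.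
by rewrite -[s]scale1r lf scale1r; apply: PD.
Qed.

Lemma tensor_span_sub (I J : A -> Prop) t :
  (forall x, I x -> J x) -> tensor_span I t -> tensor_span J t.
Proof.
move=> IJ; elim=> [a b /IJ Ja|s s' _ Js _ Js']; first exact: tensor_span_tens.
exact: tensor_spanD.
Qed.

Lemma tensor_span_all t : tensor_span (fun=> True) t.
Proof.
elim/tensor_ind: t => [a b|s t Is It]; first exact: tensor_span_tens.
exact: tensor_spanD.
Qed.

Lemma tensor_span_mul (I J L : A -> Prop) s t :
  (forall x y, I x -> J y -> L (x * y)) ->
  tensor_span I s -> tensor_span J t -> tensor_span L (s * t).
Proof.
move=> IJL Is Jt; elim: Is => [a b Ia|s1 s2 _ Ls1 _ Ls2]; last first.
  by rewrite mulrDl; apply: tensor_spanD.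
elim: Jt => [a' b' Ja'|t1 t2 _ Lt1 _ Lt2]; last first.
  by rewrite mulrDr; apply: tensor_spanD.
by rewrite tens_mul; apply: tensor_span_tens; apply: IJL.
Qed.

Variables (I : A -> Prop) (idI : twosided I).

Lemma tensor_span0 : tensor_span I 0.
Proof.
have -> : 0 = 0 \ox 0 :> tensor A B.
  have /= := scalable_linear (tens_linearl (0 : B)) 0 (0 : A).
  by rewrite !scale0r.
by apply: tensor_span_tens; apply: twosided0.
Qed.

Lemma tensor_spanN t : tensor_span I t -> tensor_span I (- t).
Proof.
apply: (tensor_span_lift (f := fun t => - t)); first by lin.
  exact: tensor_spanD.
move=> a b Ia; rewrite -scaleN1r -(scalable_linear (tens_linearl b)).
by apply: tensor_span_tens; apply: twosidedZ.
Qed.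

Lemma tensor_spanMr s t : tensor_span I t -> tensor_span I (t * s).
Proof.
move=> It; apply: (tensor_span_mul (J := fun=> True) (I := I)) => //.
  by move=> x y Ix _; apply: twosidedMr.
exact: tensor_span_all.
Qed.

Lemma tensor_span_sum (U V : lmodType K) (b : U -> V -> tensor A B) t :
  (forall u v, tensor_span I (b u v)) -> tensor_span I (tensor_lift b t).
Proof.
move=> Ib; rewrite /tensor_lift /formal_eval.
by elim/big_ind: _ => [|x y|p _] //; [apply: tensor_span0|apply: tensor_spanD].
Qed.

End TensorSpan.

Lemma tensor_span_eq0 (K : fieldType) (A B : algType K) (t : tensor A B) :
  tensor_span (fun a => a = 0) t -> t = 0.
Proof.
elim=> [a b ->|s s' _ -> _ ->]; last exact: addr0.
by have /= := scalable_linear (tens_linearl b) 0 (0 : A); rewrite !scale0r.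
Qed.

(** * The derivation given by formal smoothness *)

Section BarBimodule.
Variables (K : fieldType) (A : algType K).

(** The degree 1 term of the bar resolution: the bimodule A (x) A (x) A, with A acting on the two
    outer factors. *)
Definition bar : Type := tensor A (tensor A A).
HB.instance Definition _ := GRing.Lmodule.on bar.

Definition bar_lact (a : A) (t : bar) : bar :=
  tensor_lift (fun x s => (a * x) \ox s) t.
Definition bar_ract (t : bar) (a : A) : bar :=
  tensor_lift (fun (x : A) (s : tensor A A) => x \ox (s * (1 \ox a))) t.

Let lact_tens a x s : bar_lact a (x \ox s) = (a * x) \ox s.
Proof. by rewrite /bar_lact tensor_lift_tens //; lin. Qed.

Let ract_tens a x s : bar_ract (x \ox s) a = x \ox (s * (1 \ox a)).
Proof. by rewrite /bar_ract tensor_lift_tens //; lin. Qed.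

Let lact_lin a : linear (bar_lact a).
Proof. by rewrite /bar_lact; lin. Qed.

Let ract_lin a : linear (bar_ract^~ a).
Proof. by rewrite /bar_ract; lin. Qed.

Let lact_bil : bilinear_map bar_lact.
Proof. by split; rewrite /bar_lact; lin. Qed.

Let ract_bil : bilinear_map bar_ract.
Proof. by split; rewrite /bar_ract; lin. Qed.

Let bar_ext (f g : bar -> bar) : linear f -> linear g ->
  (forall x s, f (x \ox s) = g (x \ox s)) -> f =1 g.
Proof. exact: tensor_ext. Qed.

Let lact_1 : bar_lact 1 =1 id.
Proof. by apply: bar_ext => // x s; rewrite lact_tens mul1r. Qed.

Let ract_1 : bar_ract^~ 1 =1 id.
Proof. by apply: bar_ext => // x s; rewrite ract_tens mulr1. Qed.

Let lact_M a b : bar_lact (a * b) =1 bar_lact a \o bar_lact b.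
Proof.
apply: bar_ext => //= [|x s]; first by move=> k x y; rewrite /= !lact_lin.
by rewrite !lact_tens mulrA.
Qed.

Let ract_M a b : bar_ract^~ (a * b) =1 bar_ract^~ b \o bar_ract^~ a.
Proof.
apply: bar_ext => //= [|x s]; first by move=> k x y; rewrite /= !ract_lin.
by rewrite !ract_tens -mulrA tens_mul mulr1.
Qed.

Let lract_A a b : bar_ract^~ b \o bar_lact a =1 bar_lact a \o bar_ract^~ b.
Proof.
apply: bar_ext => [k x y|k x y|x s] /=;
  rewrite ?ract_lin ?lact_lin ?ract_lin //.
by rewrite !lact_tens !ract_tens lact_tens.
Qed.

HB.instance Definition _ := Lmodule_isBimodule.Build K A bar
  lact_bil ract_bil lact_1 ract_1 lact_M (fun a b => ract_M a b) lract_A.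

(* Up to sign the bar differential, whose image is ker mult. *)
Definition bar_boundary (t : bar) : tensor A A :=
  tensor_lift (fun a s =>
    tensor_lift (fun b c => a \ox (b * c) - (a * b) \ox c) s) t.

Lemma bar_boundary_linear : linear bar_boundary.
Proof. by rewrite /bar_boundary; lin. Qed.

Lemma bar_boundary_tens a b c :
  bar_boundary (a \ox (b \ox c)) = a \ox (b * c) - (a * b) \ox c.
Proof. by rewrite /bar_boundary !tensor_lift_tens //; lin. Qed.

Lemma mult_bar_boundary t : bar_boundary t \in lin_ker (@mult K A).
Proof.
rewrite inE; apply/eqP; elim/tensor_ind: t => [a s|s t IHs IHt]; last first.
  by rewrite -[s]scale1r bar_boundary_linear linearP IHs IHt scaler0 addr0.
elim/tensor_ind: s => [b c|s t IHs IHt]; last first.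
  rewrite -[s]scale1r tens_linearr bar_boundary_linear linearP.
  by rewrite IHs IHt scaler0 addr0.
by rewrite bar_boundary_tens linearB /= !mult_tens mulrA subrr.
Qed.

Definition bar_Omega1 (t : bar) : Omega1 A :=
  exist (fun t => t \in lin_ker (@mult K A)) _ (mult_bar_boundary t).

Let bar_Omega1_linear : linear bar_Omega1.
Proof. by move=> k x y; apply: val_inj; apply: bar_boundary_linear. Qed.

HB.instance Definition _ :=
  GRing.isLinear.Build K bar (Omega1 A) _ bar_Omega1 bar_Omega1_linear.
End BarBimodule.

Section SmoothDerivation.
Variables (K : fieldType) (A : algType K).

Lemma bar_Omega1_hom : bimodule_hom (@bar_Omega1 K A : {linear _ -> _}).
Proof.
have ext (f g : bar A -> tensor A A) : linear f -> linear g ->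
    (forall x y z, f (x \ox (y \ox z)) = g (x \ox (y \ox z))) -> f =1 g.
  move=> lf lg fg; apply: tensor_ext => // x s.
  apply: (tensor_ext (f := fun s => f (x \ox s)) (g := fun s => g (x \ox s)))
    => // k u v; by rewrite tens_linearr ?lf ?lg.
split=> a m; apply: val_inj => /=.
  apply: (ext (fun m => bar_boundary (bar_lact a m))
              (fun m => tensor_lact a (bar_boundary m))).
  - by rewrite /bar_boundary /bar_lact; lin.
  - by rewrite /bar_boundary /tensor_lact; lin.
  move=> x y z; rewrite /bar_lact tensor_lift_tens; last by lin.
  rewrite !bar_boundary_tens /tensor_lact mulrBr !tens_mul.
  by rewrite !mul1r mulrA.
apply: (ext (fun m => bar_boundary (bar_ract m a))
            (fun m => tensor_ract (bar_boundary m) a)).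
- by rewrite /bar_boundary /bar_ract; lin.
- by rewrite /bar_boundary /tensor_ract; lin.
move=> x y z; rewrite /bar_ract tensor_lift_tens; last by lin.
rewrite tens_mul !bar_boundary_tens /tensor_ract mulrBl !tens_mul.
by rewrite !mulr1 mulrA.
Qed.

(** The contracting homotopy of the bar complex: the boundary of -(1 (x) t) is t - 1 (x) mult t, and
    mult vanishes on Omega^1. *)
Lemma bar_Omega1_split :
  exists s : {linear Omega1 A -> bar A}, cancel s (@bar_Omega1 K A).
Proof.
pose s (w : Omega1 A) : bar A := - (1 \ox val w).
have ls : linear s.
  by move=> k x y; rewrite /s linearP /= tens_linearr opprD scalerN.
pose sL := HB.pack_for {linear Omega1 A -> bar A} s
  (GRing.isLinear.Build _ _ _ _ s ls).
exists sL => w; apply: val_inj => /=; rewrite /s.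
have -> (t : tensor A A) : bar_boundary (- (1 \ox t)) = t - 1 \ox mult t.
  apply: (tensor_ext (f := fun t => bar_boundary (- (1 \ox t)))
                     (g := fun t => t - 1 \ox mult t)) => [||x y].
  - by rewrite /bar_boundary; lin.
  - by lin.
  rewrite -scaleN1r (scalable_linear (@bar_boundary_linear K A)).
  by rewrite bar_boundary_tens mult_tens mul1r [LHS]scaleN1r opprB.
rewrite (eqP (valP w)).
by have /= := scalable_linear (tens_linearr (1 : A)) 0 (0 : A);
  rewrite !scale0r => ->; rewrite subr0.
Qed.

(** Projectivity lifts the identity of Omega^1 to a bimodule section [g] of the boundary. Composing
    [g] with the universal derivation a |-> 1 (x) a - a (x) 1 gives [d]. *)
Lemma formally_smooth_derivation : formally_smooth A ->
  exists d : A -> bar A,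
  [/\ linear d, forall a b, d (a * b) = lact a (d b) + ract (d a) b
    & forall a, bar_boundary (d a) = 1 \ox a - a \ox 1].
Proof.
move=> /(_ _ _ _ idfun bar_Omega1_hom bar_Omega1_split).
case=> [|g [[gl gr] gK]]; first by [].
pose du (a : A) : tensor A A := 1 \ox a - a \ox 1.
have du_lin : linear du by rewrite /du; lin.
have ker_du a : du a \in lin_ker (@mult K A).
  by rewrite inE linearB /= !mult_tens mul1r mulr1 subrr.
pose u a : Omega1 A := exist (fun t => t \in lin_ker (@mult K A)) _ (ker_du a).
exists (g \o u); split=> [k x y|a b|a] /=.
- rewrite -linearP; congr (g _); apply: val_inj => /=.
  exact: du_lin.
- rewrite -gl -gr -linearD; congr (g _); apply: val_inj => /=.
  rewrite /du /lact /ract /= /tensor_lact /tensor_ract mulrBl mulrBr !tens_mul.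
  by rewrite !mul1r !mulr1 [RHS]addrC addrA subrK.
by have /(congr1 val) := gK (u a).
Qed.

End SmoothDerivation.

(** * Newton approximation of algebra maps *)

Section Newton.
Variables (K : fieldType) (A B : algType K).

Lemma bar_twosided (J : B -> Prop) (L : bar A -> B) t :
  twosided J -> linear L ->
  (forall a b c, J (L (a \ox (b \ox c)))) -> J (L t).
Proof.
move=> idJ lL JL; elim/tensor_ind: t => [a s|s t Js Jt]; last first.
  by rewrite -[s]scale1r lL scale1r; apply: twosidedD.
elim/tensor_ind: s => [b c|s t Js Jt]; first exact: JL.
by rewrite -[s]scale1r tens_linearr lL scale1r; apply: twosidedD.
Qed.

Definition mul_defect (f : A -> B) (a b : A) : B := f a * f b - f (a * b).

Definition newton_term (f : A -> B) (t : bar A) : B :=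
  tensor_lift (fun a s => tensor_lift (fun b c => mul_defect f a b * f c) s) t.

Variables (f : {linear A -> B}) (J : B -> Prop).
Hypotheses (f1 : f 1 = 1) (idJ : twosided J).
Hypothesis Jf : forall a b, J (mul_defect f a b).

Lemma newton_term_linear : linear (newton_term f).
Proof. by rewrite /newton_term /mul_defect; lin. Qed.

Lemma newton_term_tens a b c :
  newton_term f (a \ox (b \ox c)) = mul_defect f a b * f c.
Proof. by rewrite /newton_term !tensor_lift_tens // /mul_defect; lin. Qed.

Lemma newton_term_ideal t : J (newton_term f t).
Proof.
apply: twosided_lift => // a s; apply: twosided_lift => // b c.
exact: (twosidedMr idJ).
Qed.

Variables (d : A -> bar A) (d_lin : linear d).
Hypothesis d_der : forall a b, d (a * b) = lact a (d b) + ract (d a) b.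
Hypothesis d_boundary : forall a, bar_boundary (d a) = 1 \ox a - a \ox 1.

(* The defect of f is a Hochschild 2-cocycle up to terms quadratic in it; the
   derivation d, a bimodule splitting of the bar complex in degree 1, provides
   the cochain of which it is the coboundary. *)
Definition newton (a : A) : B := f a + newton_term f (d a).

Lemma newton_linear : linear newton.
Proof.
move=> k x y; rewrite /newton d_lin newton_term_linear linearP.
by rewrite scalerDr addrACA.
Qed.

Lemma newton1 : newton 1 = 1.
Proof.
have d1 : d 1 = 0.
  have := d_der 1 1; rewrite mulr1 lact1 ract1 => /eqP.
  by rewrite -subr_eq0 opprD addrA subrr sub0r oppr_eq0 => /eqP.
rewrite /newton d1 f1.
have /= := scalable_linear newton_term_linear 0 0.
by rewrite !scale0r => ->; rewrite addr0.
Qed.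

(** Write c for the defect of f. Modulo [J2] the correction is right linear through f, and left
    linear up to [Q] of the boundary. At d b the boundary is 1 (x) b - b (x) 1, on which [Q] takes
    the value -c(a, b); this cancels the defect of f. *)
Lemma newton_defect (J2 : B -> Prop) a b :
  twosided J2 -> (forall x y, J x -> J y -> J2 (x * y)) ->
  J2 (mul_defect newton a b).
Proof.
move=> idJ2 JJ.
(* On a pure tensor the difference is c(x, y) c(z, c), a product of two defects. *)
have J2r t c : J2 (newton_term f t * f c - newton_term f (bar_ract t c)).
  apply: (bar_twosided (L := fun t =>
    newton_term f t * f c - newton_term f (bar_ract t c))) => //.
    by rewrite /newton_term /bar_ract /mul_defect; lin.
  move=> x y z; rewrite /bar_ract tensor_lift_tens; last by lin.
  by rewrite tens_mul mulr1 !newton_term_tens -mulrA -mulrBr; apply: JJ;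
    exact: Jf.
pose Q (t : tensor A A) := tensor_lift (fun x y => mul_defect f a x * f y) t.
have J2l t : J2 (f a * newton_term f t - newton_term f (bar_lact a t) -
                 Q (bar_boundary t)).
  apply: (bar_twosided (L := fun t => f a * newton_term f t -
    newton_term f (bar_lact a t) - Q (bar_boundary t))) => //.
    by rewrite /Q /newton_term /bar_lact /bar_boundary /mul_defect; lin.
  move=> x y z; rewrite /bar_lact tensor_lift_tens; last by lin.
  rewrite bar_boundary_tens !newton_term_tens.
  have -> : Q (x \ox (y * z) - (x * y) \ox z) =
            mul_defect f a x * f (y * z) - mul_defect f a (x * y) * f z.
    have lQ : linear Q by rewrite /Q /mul_defect; lin.
    rewrite -scaleN1r addrC lQ scaleN1r addrC /Q !tensor_lift_tens //;
      by rewrite /mul_defect; lin.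
  (* The identity f a c(x, y) - c(a x, y) + c(a, x y) = c(a, x) f y, multiplied by f z, turns the
     expression into c(a, x) (f y f z - f (y z)). *)
  suff -> : f a * (mul_defect f x y * f z) - mul_defect f (a * x) y * f z -
      (mul_defect f a x * f (y * z) - mul_defect f a (x * y) * f z) =
      mul_defect f a x * mul_defect f y z by apply: JJ; exact: Jf.
  rewrite /mul_defect !(mulrBl, mulrBr) !mulrA.
  rewrite ![- (_ - (_ : B))]opprB.
  rewrite [LHS](AC (2*2*(2*2)) ((1*8)*(7*4)*((5*2)*(3*6)))) /=.
  by rewrite !subrr !addr0.
rewrite /mul_defect /newton d_der.
have -> : newton_term f (lact a (d b) + ract (d a) b) =
  newton_term f (bar_lact a (d b)) + newton_term f (bar_ract (d a) b).
  by rewrite -[lact a _]scale1r newton_term_linear !scale1r.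
suff -> : (f a + newton_term f (d a)) * (f b + newton_term f (d b)) -
    (f (a * b) + (newton_term f (bar_lact a (d b)) +
                  newton_term f (bar_ract (d a) b))) =
    newton_term f (d a) * f b - newton_term f (bar_ract (d a) b) +
    (f a * newton_term f (d b) - newton_term f (bar_lact a (d b)) -
       Q (bar_boundary (d b))) + newton_term f (d a) * newton_term f (d b).
  apply: twosidedD => //; first exact: twosidedD.
  by apply: JJ; apply: newton_term_ideal.
(* The other summand, c(a, 1) f b, vanishes because f 1 = 1. *)
have -> : Q (bar_boundary (d b)) = - mul_defect f a b.
  have lQ : linear Q by rewrite /Q /mul_defect; lin.
  rewrite d_boundary -scaleN1r addrC lQ scaleN1r /Q !tensor_lift_tens;
    try by rewrite /mul_defect; lin.
  by rewrite /mul_defect f1 !mulr1 subrr mul0r addr0.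
rewrite opprK mulrDl !mulrDr !opprD.
by rewrite (AC (2*2*(1*2)) ((3*7)*((2*6)*(1*5))*4)).
Qed.
End Newton.

Lemma lrmorphism_of_linear (K : fieldType) (A B : algType K)
    (f : {linear A -> B}) :
  f 1 = 1 -> (forall a b, f (a * b) = f a * f b) ->
  exists s : {lrmorphism A -> B}, s =1 f.
Proof.
move=> f1 fM.
pose s := HB.pack_for {lrmorphism A -> B} (f : A -> B)
  (GRing.isMonoidMorphism.Build A B f (f1, fM)) (GRing.Linear.on (f : A -> B)).
by exists s.
Qed.

Lemma linear_pack (K : fieldType) (U V : lmodType K) (f : U -> V) :
  linear f -> exists g : {linear U -> V}, g =1 f.
Proof.
move=> lf.
by exists (HB.pack_for {linear U -> V} f (GRing.isLinear.Build _ _ _ _ f lf)).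
Qed.

(** Induction on a bound m for n - r, which drops at each step because doubling a positive r adds at
    least one. Every correction lies in the initial I^r, so the limit stays congruent to [f]; once r
    reaches n the defect is zero. *)
Lemma newton_lift (K : fieldType) (A B : algType K) (I : B -> Prop) n r
    (f : {linear A -> B}) :
  formally_smooth A -> twosided I -> (forall x, ideal_power I n x -> x = 0) ->
  (0 < r)%N -> f 1 = 1 -> (forall a b, ideal_power I r (mul_defect f a b)) ->
  exists s : {lrmorphism A -> B}, forall a, ideal_power I r (s a - f a).
Proof.
move=> /formally_smooth_derivation[d [d_lin d_der d_bd]] idI nilI.
have idP := ideal_power_twosided idI.
have [m] : exists m, (n <= m + r)%N by exists n; rewrite leq_addr.
elim: m r f => [|m IHm] r f nr r0 f1 cf.
  have [|s sf] := lrmorphism_of_linear f1.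
    move=> a b; apply/esym/eqP; rewrite -subr_eq0; apply/eqP/nilI.
    exact: ideal_power_leq nr (cf a b).
  by exists s => a; rewrite sf subrr; apply: twosided0.
have [g gf] := linear_pack (newton_linear f d_lin).
have cg a b : ideal_power I (r + r) (mul_defect g a b).
  rewrite /mul_defect !gf.
  change (ideal_power I (r + r) (mul_defect (newton f d) a b)).
  apply: (newton_defect (J := ideal_power I r) (J2 := ideal_power I (r + r))
    f1 (idP r) cf d_der d_bd a b (idP _)).
  by move=> x y; apply: ideal_power_mul.
have [|||s sg] := IHm _ _ _ _ _ cg.
- by rewrite (leq_trans nr) // addSnnS leq_add2l -[r.+1]addn1 leq_add2l.
- by rewrite addn_gt0 r0.
- by rewrite gf (newton1 f1).
exists s => a; rewrite -[s a](subrK (g a)) -addrA; apply: twosidedD => //.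
  by apply: ideal_power_leq (sg a); rewrite leq_addr.
by rewrite gf /newton addrC addKr; apply: newton_term_ideal.
Qed.

(** * Linear sections of surjective linear maps *)

Section LinearSection.
Variables (K : fieldType) (U V : lmodType K) (p : {linear U -> V}).

Let subspace (L : set U) : Prop :=
  [/\ forall k x y, L x -> L y -> L (k *: x + y)
    & forall x, L x -> p x = 0 -> x = 0].

(** Zorn's lemma gives a maximal subspace on which p is injective; maximality makes p map it onto V,
    and the section is the inverse. *)
Lemma linear_section : (forall v, exists u, p u = v) ->
  exists s : {linear V -> U}, cancel s p.
Proof.
move=> p_surj.
have [F Fsub Ftot|L [[Llin Lker] Lmax]] :=
  @Zorn_bigcup U [set L | subspace L]%classic.
  split=> [k x y [X FX Xx] [Y FY Yy]|x [X FX Xx]]; last first.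
    by case: (Fsub X FX) => _; apply.
  have [XY|YX] := Ftot X Y FX FY.
    by exists Y => //; case: (Fsub Y FY) => lY _; apply: lY => //; apply: XY.
  by exists X => //; case: (Fsub X FX) => lX _; apply: lX => //; apply: YX.
have p_inj x y : L x -> L y -> p x = p y -> x = y.
  move=> Lx Ly pxy; apply/eqP; rewrite -subr_eq0 addrC -scaleN1r; apply/eqP.
  by apply: Lker; [apply: Llin | rewrite linearP pxy scaleN1r addNr].
suff L_surj v : exists x, L x /\ p x = v.
  have [s sP] := choice L_surj.
  have ls : linear s.
    move=> k x y; have [Lx px] := sP x; have [Ly py] := sP y.
    have [Lxy pxy] := sP (k *: x + y).
    by apply: p_inj => //; [apply: Llin | rewrite pxy linearP px py].
  by have [t ts] := linear_pack ls; exists t => v; rewrite ts; case: (sP v).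
have [u <-] := p_surj v; apply: contrapT => noL.
(* [subspace] also holds of the empty set, the union of the empty chain, so 0 in L is drawn from
   maximality by comparison with {0}. *)
have L0 : L 0.
  apply: contrapT => nL0; apply: (Lmax [set 0]%classic).
    split=> [x Lx|/(_ 0 erefl)//]; case: nL0.
    by rewrite -(addNr x) -scaleN1r; apply: Llin.
  by split=> [k x y -> ->|x -> //]; rewrite scaler0 addr0.
have LZ k x : L x -> L (k *: x).
  by move=> Lx; rewrite -[_ *: _]addr0; apply: Llin.
(* The span of L and u strictly contains L. If p killed k u + x with k nonzero, then -k^-1 x would
   be an element of L above p u. *)
apply: (Lmax [set z | exists k x, L x /\ z = k *: u + x]%classic).
  split=> [x Lx|ML]; first by exists 0, x; rewrite scale0r add0r.
  apply: noL; exists u; split=> //; apply: ML; exists 1, 0.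
  by rewrite scale1r addr0.
split=> [k _ _ [a [x [Lx ->]]] [b [y [Ly ->]]]|_ [k [x [Lx ->]]]].
  exists (k * a + b), (k *: x + y); split; first exact: Llin.
  by rewrite scalerDr scalerDl scalerA addrACA.
have [-> |k0] := eqVneq k 0; first by rewrite scale0r add0r; apply: Lker.
rewrite linearP => /eqP; rewrite addr_eq0 => /eqP kpu; case: noL.
exists (- k^-1 *: x); split; first exact: LZ.
by rewrite linearZ /= scaleNr -scalerN -kpu scalerA mulVf // scale1r.
Qed.

End LinearSection.

(** * Colinearization *)

Lemma tensor_mapM (K : fieldType) (A A' B B' : algType K)
    (f : {lrmorphism A -> A'}) (g : {lrmorphism B -> B'}) :
  {morph tensor_map f g : s t / s * t}.
Proof.
move=> s t; elim/tensor_ind: s => [a b|s s' IHs IHs']; last first.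
  by rewrite mulrDl !linearD /= IHs IHs' mulrDl.
elim/tensor_ind: t => [a' b'|t t' IHt IHt']; last first.
  by rewrite mulrDr !linearD /= IHt IHt' mulrDr.
by rewrite tens_mul /= !tensor_map_tens tens_mul !rmorphM.
Qed.

Section Colinearization.
Variables (K : fieldType) (H : hopfType K) (E : bialgType K).
Variables (p : {lrmorphism E -> H}) (p_hom : bialgebra_hom p).
Variable (s : {lrmorphism H -> E}).

Definition coaction (e : E) : tensor E H := tensor_map idfun p (comul e).

Lemma coaction_linear : linear coaction.
Proof. by move=> k x y; rewrite /coaction !linearP. Qed.

HB.instance Definition _ :=
  GRing.isLinear.Build K E (tensor E H) _ coaction coaction_linear.

Lemma coactionM : {morph coaction : x y / x * y}.
Proof. by move=> x y; rewrite /coaction comulM tensor_mapM. Qed.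

Lemma coaction1 : coaction 1 = 1.
Proof. by rewrite /coaction comul1 /= tensor_map_tens (rmorph1 p). Qed.

Lemma coactionE e : coaction e = tensor_lift (fun x y => x \ox p y) (comul e).
Proof. by []. Qed.

(** This is (f (x) H) Delta, so f is colinear when it equals rho f. Written as a lift, it also
    applies to bare functions such as [colin]. *)
Definition free_coaction (f : H -> E) (h : H) : tensor E H :=
  tensor_lift (fun x y => f x \ox y) (comul h).

Let G2 := free_coaction s.

Lemma free_coaction_linear : linear G2.
Proof. by rewrite /G2 /free_coaction; lin. Qed.

HB.instance Definition _ :=
  GRing.isLinear.Build K H (tensor E H) _ G2 free_coaction_linear.

Lemma free_coactionM : {morph G2 : x y / x * y}.
Proof.
have G2E h : G2 h = tensor_map s idfun (comul h) by [].
by move=> x y; rewrite !G2E comulM tensor_mapM.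
Qed.

Lemma free_coaction1 : G2 1 = 1.
Proof.
by rewrite /G2 /free_coaction comul1 tensor_lift_tens ?rmorph1 //; lin.
Qed.

(** For a colinear s this is the projection onto the coinvariants from the structure theorem of Hopf
    modules; here s is colinear only up to its defect. *)
Definition theta (e : E) : E :=
  tensor_lift (fun x y => x * s (antipode (p y))) (comul e).

Lemma theta_linear : linear theta.
Proof. by rewrite /theta; lin. Qed.

HB.instance Definition _ := GRing.isLinear.Build K E E _ theta theta_linear.

Lemma theta1 : theta 1 = 1.
Proof.
rewrite /theta comul1 tensor_lift_tens; last by lin.
by rewrite rmorph1 antipode1 rmorph1 mulr1.
Qed.

(** S reverses products, so s(S e'_1) lands next to e'_0 and the sum over e' closes up to theta
    e'. *)
Lemma thetaM e e' :
  theta (e * e') =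
  tensor_lift (fun x y => x * theta e' * s (antipode (p y))) (comul e).
Proof.
rewrite {1}/theta comulM lift_mul; last by lin.
apply: eq_lift => x y.
rewrite /theta (lift_linear (f := fun z => x * z * s (antipode (p y))));
  last by lin.
by apply: eq_lift => x' y'; rewrite !rmorphM antipodeM rmorphM !mulrA.
Qed.

Lemma counit_hom e : counit (p e) = counit e.
Proof. exact: p_hom.2. Qed.

(** The product s(S p(e_2)) s(p(e_3)) collapses to the counit, as S is a left convolution inverse of
    the identity and p preserves comultiplication and counit. *)
Lemma theta_conv e : tensor_lift (fun x y => theta x * s (p y)) (comul e) = e.
Proof.
transitivity (tensor_lift (fun x y => tensor_lift (fun u v =>
    u * s (antipode (p v)) * s (p y)) (comul x)) (comul e)).
  apply: eq_lift => x y.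
  rewrite /theta (lift_linear (f := fun z => z * s (p y))) //.
  by lin.
rewrite (sweedler_assoc (t := fun u v y => u * s (antipode (p v)) * s (p y)));
  try by lin.
rewrite -[RHS](sweedler_counitr (f := fun x => x)); last by lin.
apply: eq_lift => x y; rewrite -counit_hom -[X in _ *: X]mulr1 -(rmorph1 s).
rewrite -(sweedler_antipodel (f := fun z => x * s z)); last by lin.
rewrite (sweedler_hom _ p_hom); last by lin.
by apply: eq_lift => u v; rewrite rmorphM mulrA.
Qed.

Lemma coaction_theta_conv e :
  coaction e = tensor_lift (fun x y => (theta x \ox 1) * G2 (p y)) (comul e).
Proof.
transitivity (tensor_lift (fun x y => tensor_lift (fun u v =>
    (theta x * s (p u)) \ox p v) (comul y)) (comul e)); last first.
  apply: eq_lift => x y; rewrite /G2 /free_coaction.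
  rewrite (sweedler_hom _ p_hom); last by lin.
  rewrite (lift_linear (f := fun z => (theta x \ox 1) * z)); last by lin.
  by apply: eq_lift => u v; rewrite tens_mul mul1r.
rewrite -(sweedler_assoc (t := fun x u v => (theta x * s (p u)) \ox p v));
  try by lin.
rewrite coactionE; apply: eq_lift => x y.
by rewrite -(lift_linear (f := fun z => z \ox p y)) ?theta_conv //; lin.
Qed.

(** [G2] is an algebra map, so G2 S p is a convolution inverse of G2 p; it cancels the second factor
    in [coaction_theta_conv]. *)
Lemma theta_tens1 e :
  tensor_lift (fun x y => coaction x * G2 (antipode (p y))) (comul e) =
  theta e \ox 1.
Proof.
transitivity (tensor_lift (fun x y => tensor_lift (fun u v =>
    (theta u \ox 1) * G2 (p v) * G2 (antipode (p y))) (comul x)) (comul e)).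
  apply: eq_lift => x y; rewrite coaction_theta_conv.
  rewrite (lift_linear (f := fun z : tensor E H => z * G2 (antipode (p y)))) //.
  by lin.
rewrite (sweedler_assoc (t := fun u v y =>
  (theta u \ox 1) * G2 (p v) * G2 (antipode (p y)))); try by lin.
rewrite -[RHS](sweedler_counitr (f := fun x => theta x \ox 1)); last by lin.
apply: eq_lift => x y; rewrite -counit_hom -[X in _ *: X]mulr1 -free_coaction1.
rewrite -(sweedler_antipoder (f := fun z => (theta x \ox 1) * G2 z));
  last by lin.
rewrite (sweedler_hom _ p_hom); last by lin.
by apply: eq_lift => u v; rewrite free_coactionM mulrA.
Qed.

Definition colin (h : H) : E :=
  tensor_lift (fun x y => theta (s x) * s y) (comul h).

Definition colin_defect (f : H -> E) (h : H) : tensor E H :=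
  coaction (f h) - free_coaction f h.

Let D := colin_defect s.

Lemma colin_linear : linear colin.
Proof. by rewrite /colin; lin. Qed.

Lemma colin_defect_linear : linear D.
Proof. by rewrite /D /colin_defect /free_coaction; lin. Qed.

HB.instance Definition _ :=
  GRing.isLinear.Build K H (tensor E H) _ D colin_defect_linear.

Lemma coaction_split h : coaction (s h) = G2 h + D h.
Proof. by rewrite addrC subrK. Qed.

(** At rho(e) this is e_0 z s(S e_1), which is theta(e e') for z = theta e'. Being linear in the
    tensor, it splits along rho(s h) = G2 h + D h into an exact part and an error. *)
Let act (z : E) (t : tensor E H) : E :=
  tensor_lift (fun e y => e * z * s (antipode y)) t.

Let act_linear z : linear (act z).
Proof. by rewrite /act; lin. Qed.

Let act_linearl k z z' t : act (k *: z + z') t = k *: act z t + act z' t.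
Proof.
suff lz : linear (act^~ t) by apply: lz.
by rewrite /act; lin.
Qed.

Let theta_act e e' : theta (e * e') = act (theta e') (coaction e).
Proof. by rewrite thetaM /act /coaction lift_map //; lin. Qed.

Let act_free z h :
  act z (G2 h) = tensor_lift (fun x y => s x * z * s (antipode y)) (comul h).
Proof.
rewrite {1}/G2 /free_coaction (lift_linear (f := act z)) //.
by apply: eq_lift => x y; rewrite /act tensor_lift_tens //; lin.
Qed.

Lemma colin1 : colin 1 = 1.
Proof.
rewrite /colin comul1 tensor_lift_tens; last by lin.
by rewrite rmorph1 theta1 mulr1.
Qed.

Let act1_free h : act 1 (G2 h) = (counit h : K) *: 1.
Proof.
rewrite act_free -(rmorph1 s) -(sweedler_antipoder (f := s)); last by lin.
by apply: eq_lift => x y; rewrite rmorph1 mulr1 rmorphM.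
Qed.

(** The adjoint action s(h_1) z s(S h_2), followed by s(h_3), telescopes to s(h) z. *)
Let act_conv z w h :
  tensor_lift (fun x y => act z (G2 x) * (s y * w)) (comul h) = s h * (z * w).
Proof.
transitivity (tensor_lift (fun x y => tensor_lift (fun u v =>
    s u * z * s (antipode v) * (s y * w)) (comul x)) (comul h)).
  apply: eq_lift => x y; rewrite act_free.
  by rewrite (lift_linear (f := fun e => e * (s y * w))) //; lin.
rewrite (sweedler_assoc (t := fun u v y =>
  s u * z * s (antipode v) * (s y * w))); try by lin.
rewrite -[RHS](sweedler_counitr (f := fun x => s x * (z * w))); last by lin.
apply: eq_lift => x y; rewrite -[in RHS](mul1r w) -[in RHS](rmorph1 s).
rewrite -(sweedler_antipodel (f := fun e => s x * (z * (s e * w))));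
  last by lin.
by apply: eq_lift => u v; rewrite rmorphM !mulrA.
Qed.

Let theta_defect h : theta (s h) = (counit h : K) *: 1 + act 1 (D h).
Proof.
rewrite -[s h]mulr1 theta_act theta1 coaction_split -act1_free.
by rewrite -[G2 h]scale1r act_linear !scale1r.
Qed.

Let colin_sub h : colin h - s h =
  tensor_lift (fun x y => act 1 (D x) * s y) (comul h).
Proof.
apply/eqP; rewrite subr_eq addrC; apply/eqP.
rewrite -[X in X + _](sweedler_counitl (f := s)); last by lin.
rewrite -lift_add; apply: eq_lift => x y.
by rewrite theta_defect mulrDl -scalerAl mul1r.
Qed.

Variables (J J2 : E -> Prop) (idJ : twosided J) (idJ2 : twosided J2).
Hypothesis JJ : forall x y, J x -> J y -> J2 (x * y).
Hypothesis DJ : forall h, tensor_span J (D h).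

Let act_ideal z h : J (act z (D h)).
Proof.
apply: (tensor_span_lift (f := act z) _ (twosidedD idJ)) (DJ h) => // e y Je.
rewrite /act tensor_lift_tens; last by lin.
by rewrite -mulrA; apply: twosidedMr.
Qed.

Lemma colin_sub_ideal h : J (colin h - s h).
Proof.
by rewrite colin_sub; apply: twosided_lift => // x y; apply: twosidedMr.
Qed.

Let act_ideal2 z h : J z -> J2 (act z (D h)).
Proof.
move=> Jz.
apply: (tensor_span_lift (f := act z) _ (twosidedD idJ2)) (DJ h) => //.
move=> e y Je; rewrite /act tensor_lift_tens; last by lin.
by apply: twosidedMr => //; apply: JJ.
Qed.

(** Expanding colin(h k) along rho s = G2 + D shows that the defect is (colin h - s h)(colin k - s
    k) - r, and both terms are quadratic in D. *)
Lemma colin_mul_defect h k : J2 (mul_defect colin h k).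
Proof.
pose r := tensor_lift (fun x y => tensor_lift (fun u v =>
  act (act 1 (D u)) (D x) * (s y * s v)) (comul k)) (comul h).
have -> : mul_defect colin h k = (colin h - s h) * (colin k - s k) - r.
  suff -> : mul_defect colin h k = colin h * colin k -
      (s h * colin k + ((colin h - s h) * s k + r)).
    by rewrite mulrBr (mulrBl (colin k)) !opprD !addrA.
  congr (_ - _).
  (* [T1] is the G2 part, equal to s h colin k. In the D part, theta(s u) = eps(u) + act 1 (D u)
     separates [T2], equal to (colin h - s h) s k, from [r]. *)
  pose T1 := tensor_lift (fun x y => tensor_lift (fun u v =>
    act (theta (s u)) (G2 x) * (s y * s v)) (comul k)) (comul h).
  pose T2 := tensor_lift (fun x y => tensor_lift (fun u v =>
    (counit u : K) *: (act 1 (D x) * (s y * s v))) (comul k)) (comul h).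
  have -> : colin (h * k) = T1 + (T2 + r).
    rewrite /colin comulM lift_mul; last by lin.
    rewrite -!lift_add; apply: eq_lift => x y.
    rewrite -!lift_add; apply: eq_lift => u v.
    rewrite !rmorphM theta_act coaction_split scalerAl -!mulrDl; congr (_ * _).
    rewrite -[G2 x]scale1r act_linear !scale1r; congr (_ + _).
    by rewrite theta_defect act_linearl.
  congr (_ + (_ + _)).
    rewrite /T1 lift_swap /colin (lift_linear (f := fun z => s h * z));
      last by lin.
    by apply: eq_lift => u v; rewrite act_conv.
  rewrite colin_sub (lift_linear (f := fun z => z * s k)); last by lin.
  apply: eq_lift => x y.
  rewrite (sweedler_counitl (f := fun v => act 1 (D x) * (s y * s v)));
    last by lin.
  by rewrite mulrA.
apply: twosidedB => //; first by apply: JJ; apply: colin_sub_ideal.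
apply: twosided_lift => // x y; apply: twosided_lift => // u v.
by apply: twosidedMr => //; apply: act_ideal2.
Qed.


(** At rho(e) this gives rho(theta e) for g = rho s and theta e (x) 1 for g = G2. *)
Let psi (g : H -> tensor E H) (t : tensor E H) : tensor E H :=
  tensor_lift (fun e y => coaction e * g (antipode y)) t.

Let psi_linear (g : {linear H -> tensor E H}) : linear (psi g).
Proof. by rewrite /psi; lin. Qed.

Let psi_tens (g : {linear H -> tensor E H}) e y :
  psi g (e \ox y) = coaction e * g (antipode y).
Proof. by rewrite /psi tensor_lift_tens //; lin. Qed.

(** For an algebra map g the factors g(S h_2) g(h_3) cancel. The value does not depend on g, so
    these terms drop out when rho s is compared with G2. *)
Let psi_free (g : {linear H -> tensor E H}) h :
  g 1 = 1 -> {morph g : x y / x * y} ->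
  tensor_lift (fun x y => psi g (G2 x) * g y) (comul h) = coaction (s h).
Proof.
move=> g1 gM.
transitivity (tensor_lift (fun x y => tensor_lift (fun u v =>
    coaction (s u) * g (antipode v) * g y) (comul x)) (comul h)).
  apply: eq_lift => x y; have lpsi := psi_linear g.
  rewrite {1}/G2 /free_coaction (lift_linear (f := fun t => psi g t * g y));
    last by lin.
  by apply: eq_lift => u v; rewrite psi_tens.
rewrite (sweedler_assoc (t := fun u v y =>
  coaction (s u) * g (antipode v) * g y)); try by lin.
rewrite -[RHS](sweedler_counitr (f := fun x => coaction (s x))); last by lin.
apply: eq_lift => x y; rewrite -[X in _ *: X]mulr1 -g1.
rewrite -(sweedler_antipodel (f := fun z => coaction (s x) * g z)); last by lin.
by apply: eq_lift => u v; rewrite gM mulrA.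
Qed.

Let coaction_colin h : coaction (colin h) =
  tensor_lift (fun x y => psi (coaction \o s) (coaction (s x)) * coaction (s y))
    (comul h).
Proof.
rewrite /colin (lift_linear (f := coaction)); last by lin.
apply: eq_lift => x y; rewrite coactionM; congr (_ * _).
rewrite /theta (lift_linear (f := coaction)); last by lin.
rewrite /psi [in RHS]/coaction lift_map; last by lin.
by apply: eq_lift => u v; rewrite coactionM.
Qed.

Let free_coaction_colin h : free_coaction colin h =
  tensor_lift (fun x y => psi G2 (coaction (s x)) * G2 y) (comul h).
Proof.
transitivity (tensor_lift (fun x y => tensor_lift (fun u v =>
    (theta (s u) * s v) \ox y) (comul x)) (comul h)).
  apply: eq_lift => x y; rewrite /colin.
  by rewrite (lift_linear (f := fun e => e \ox y)) //; lin.
rewrite (sweedler_assoc (t := fun u v y => (theta (s u) * s v) \ox y));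
  try by lin.
apply: eq_lift => x y.
have -> : psi G2 (coaction (s x)) = theta (s x) \ox 1.
  by rewrite -theta_tens1 /psi [in LHS]/coaction lift_map //; lin.
rewrite [in RHS]/G2 /free_coaction.
rewrite (lift_linear (f := fun z => (theta (s x) \ox 1) * z)); last by lin.
by apply: eq_lift => u v; rewrite tens_mul mul1r.
Qed.

Hypothesis coactionJ : forall e, J e -> tensor_span J (coaction e).

(** After [psi_free] removes the G2 parts, psi of rho s at D(h_1) times rho(s h_2), minus psi of G2
    at D(h_1) times G2(h_2), remains. Adding and subtracting psi of G2 at D(h_1) times rho(s h_2)
    leaves two terms, each containing D twice. *)
Lemma colin_colin_defect h : tensor_span J2 (colin_defect colin h).
Proof.
have lpsi1 := psi_linear (coaction \o s).
have lpsi2 := psi_linear G2.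
have -> : colin_defect colin h = tensor_lift (fun x y =>
    tensor_lift (fun e z => coaction e * D (antipode z)) (D x) *
    coaction (s y) +
    psi G2 (D x) * D y) (comul h).
  rewrite /colin_defect coaction_colin free_coaction_colin.
  transitivity (tensor_lift (fun x y =>
      psi (coaction \o s) (G2 x) * coaction (s y)) (comul h) -
    tensor_lift (fun x y => psi G2 (G2 x) * G2 y) (comul h) +
    tensor_lift (fun x y => psi (coaction \o s) (D x) * coaction (s y)
      - psi G2 (D x) * G2 y) (comul h)).
    rewrite -!lift_opp -!lift_add; apply: eq_lift => x y.
    rewrite [in LHS]coaction_split -[G2 x]scale1r lpsi1 lpsi2 !scale1r.
    by rewrite !mulrDl opprD addrACA.
  have cs1 : (coaction \o s) 1 = 1 by rewrite /= rmorph1 coaction1.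
  have csM : {morph coaction \o s : x y / x * y}.
    by move=> x y /=; rewrite rmorphM coactionM.
  rewrite (psi_free h cs1 csM) (psi_free h free_coaction1 free_coactionM).
  rewrite subrr add0r; apply: eq_lift => x y.
  have -> : tensor_lift (fun e z => coaction e * D (antipode z)) (D x) =
      psi (coaction \o s) (D x) - psi G2 (D x).
    rewrite /psi -lift_opp -lift_add; apply: eq_lift => e z.
    by rewrite -mulrBr.
  by rewrite mulrBl [in RHS]/D /colin_defect mulrBr addrA subrK.
apply: tensor_span_sum => // x y; apply: tensor_spanD.
  apply: tensor_spanMr => //.
  apply: (tensor_span_lift _ (@tensor_spanD _ _ _ J2)) (DJ x).
    by lin.
  move=> e z Je; rewrite tensor_lift_tens; last by lin.
  exact: (tensor_span_mul JJ (coactionJ Je) (DJ _)).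
apply: (tensor_span_mul JJ _ (DJ y)).
apply: (tensor_span_lift lpsi2 (@tensor_spanD _ _ _ J)) (DJ x) => e z Je.
by rewrite psi_tens; apply: tensor_spanMr => //; apply: coactionJ.
Qed.

End Colinearization.

(** * Powers of the kernel under the coaction, and the refinement step *)

Lemma tens_subl (K : fieldType) (U V : lmodType K) (u u' : U) (v : V) :
  (u - u') \ox v = u \ox v - u' \ox v.
Proof. by rewrite -scaleN1r addrC tens_linearl scaleN1r addrC. Qed.

Section KernelCoaction.
Variables (K : fieldType) (H : hopfType K) (E : bialgType K).
Variables (p : {lrmorphism E -> H}) (p_hom : bialgebra_hom p).
Variables (f : {linear H -> E}) (fK : cancel f p).

Let I (e : E) : Prop := p e = 0.

Lemma ker_twosided : twosided I.
Proof.
rewrite /I; split=> [|x y px py|a x px|a x px].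
- exact: rmorph0.
- by rewrite rmorphD /= px py addr0.
- by rewrite rmorphM /= px mulr0.
by rewrite rmorphM /= px mul0r.
Qed.

(** Subtracting the zero tensor (f p (x) id) t rewrites t as a sum of (x - f(p x)) (x) y, whose left
    factors are killed by p. *)
Lemma tensor_span_ker (t : tensor E H) :
  tensor_map p idfun t = 0 -> tensor_span I t.
Proof.
move=> pt.
have -> : t = tensor_lift (fun x y => (x - f (p x)) \ox y) t.
  transitivity (tensor_lift tens t - tensor_map f idfun (tensor_map p idfun t)).
    by rewrite tensor_liftE pt linear0 subr0.
  have -> : tensor_map f idfun (tensor_map p idfun t) =
      tensor_lift (fun x y => f (p x) \ox y) t.
    by rewrite {1}/tensor_map lift_map //; lin.
  rewrite -lift_opp -lift_add; apply: eq_lift => x y.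
  by rewrite tens_subl.
apply: tensor_span_sum; first exact: ker_twosided.
by move=> x y; apply: tensor_span_tens; rewrite /I rmorphB /= fK subrr.
Qed.

Lemma coaction_hom e : tensor_map p idfun (coaction p e) = comul (p e).
Proof.
rewrite (proj1 p_hom) /coaction {1}/tensor_map lift_map; last by lin.
by [].
Qed.

Lemma coaction_ker e : I e -> tensor_span I (coaction p e).
Proof.
by move=> pe; apply: tensor_span_ker; rewrite coaction_hom pe linear0.
Qed.

Lemma coaction_ker_power r e :
  ideal_power I r e -> tensor_span (ideal_power I r) (coaction p e).
Proof.
elim=> {r e} [x|r x y Ix _ IHy|r x y _ IHx _ IHy].
- by apply: tensor_span_sub (tensor_span_all _) => z _; apply: ideal_power0.
- rewrite coactionM; apply: tensor_span_mul (coaction_ker Ix) IHy.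
  by move=> u v; apply: ideal_powerM.
by rewrite linearD; apply: tensor_spanD.
Qed.

(** Both halves of the defect become Delta h under p (x) id. This supplies the starting exponent
    1. *)
Lemma colin_defect_ker (s : {linear H -> E}) h :
  cancel s p -> tensor_span I (colin_defect p s h).
Proof.
move=> sK; apply: tensor_span_ker; rewrite linearB /= coaction_hom sK.
apply/eqP; rewrite subr_eq0; apply/eqP.
rewrite /free_coaction (lift_linear (f := tensor_map p idfun)); last by lin.
rewrite -[LHS]tensor_liftE; apply: eq_lift => x y.
by rewrite tensor_map_tens /= sK.
Qed.

(** The defect is linear in the map, and both of its halves send a map with values in J into the
    span of J (x) H. *)
Lemma colin_defect_congr (J : E -> Prop) (s s' : {linear H -> E}) h :
  twosided J -> (forall e, J e -> tensor_span J (coaction p e)) ->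
  (forall h, J (s' h - s h)) ->
  tensor_span J (colin_defect p s h) -> tensor_span J (colin_defect p s' h).
Proof.
move=> idJ coJ ss' Js.
have -> : colin_defect p s' h = colin_defect p s h + (coaction p (s' h - s h) -
    tensor_lift (fun x y => (s' x - s x) \ox y) (comul h)).
  have -> : tensor_lift (fun x y => (s' x - s x) \ox y) (comul h) =
      free_coaction s' h - free_coaction s h.
    rewrite /free_coaction -lift_opp -lift_add; apply: eq_lift => x y.
    by rewrite tens_subl.
  rewrite linearB /= /colin_defect [- (_ - _)]opprB.
  rewrite [RHS](AC (2*(2*2)) ((3*6)*(1*4)*(5*2))) /=.
  by rewrite !subrr !addr0.
apply: tensor_spanD => //; apply: tensor_spanD; first exact: coJ.
apply: tensor_spanN => //; apply: tensor_span_sum => // x y.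
exact: tensor_span_tens.
Qed.

(** [colin] is colinear and multiplicative modulo I^2r. [newton_lift] makes it multiplicative by a
    change inside I^2r, which keeps the bound on colinearity; all changes lie in I, so the result is
    still a section. *)
Lemma colinear_refinement r (s : {lrmorphism H -> E}) n :
  formally_smooth H -> (forall x, ideal_power I n x -> x = 0) -> (0 < r)%N ->
  cancel s p ->
  (forall h, tensor_span (ideal_power I r) (colin_defect p s h)) ->
  exists s' : {lrmorphism H -> E}, cancel s' p /\
    forall h, tensor_span (ideal_power I (r + r)) (colin_defect p s' h).
Proof.
move=> smooth nilI r0 sK Ds.
have idI := ker_twosided; have idP := ideal_power_twosided idI.
have PM x y : ideal_power I r x -> ideal_power I r y ->
    ideal_power I (r + r) (x * y).
  exact: ideal_power_mul.
have [g gE] := linear_pack (colin_linear p s).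
have cg a b : ideal_power I (r + r) (mul_defect g a b).
  rewrite /mul_defect !gE.
  exact: (colin_mul_defect (idP r) (idP (r + r)) PM Ds).
have [||s' s'g] := newton_lift smooth idI nilI _ _ cg.
- by rewrite addn_gt0 r0.
- by rewrite gE colin1.
exists s'; split=> h.
  have /(ideal_power_sub idI) : ideal_power I r (s' h - s h).
    rewrite -[s' h](subrK (g h)) -addrA; apply: twosidedD => //.
      by apply: ideal_power_leq (s'g h); rewrite leq_addr.
    by rewrite gE; apply: (colin_sub_ideal (idP r) Ds).
  by move=> /(_ r0); rewrite /I rmorphB /= sK => /eqP; rewrite subr_eq0 => /eqP.
apply: (colin_defect_congr (idP _) (@coaction_ker_power _) s'g).
rewrite /colin_defect gE /free_coaction.
have -> : tensor_lift (fun x y => g x \ox y) (comul h) =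
    free_coaction (colin p s) h by apply: eq_lift => x y; rewrite gE.
exact: (colin_colin_defect p_hom (idP r) (idP (r + r)) PM Ds
  (@coaction_ker_power r)).
Qed.

End KernelCoaction.

(** * The iteration and its termination *)

Theorem theorem5p10 (K : fieldType) (H : hopfType K) (E : bialgType K)
    (pi : {lrmorphism E -> H}) :
  bialgebra_hom pi ->
  (forall h : H, exists e : E, pi e = h) ->
  formally_smooth H ->
  nilpotent_ideal (lin_ker pi) ->
  exists sigma : {lrmorphism H -> E},
    cancel sigma pi /\
    colinear (@comul K H) (fun e : E => tensor_map idfun pi (comul e)) sigma.
Proof.
move=> pi_hom pi_surj smooth [n nil_pi].
pose I (e : E) := pi e = 0; have idI : twosided I := ker_twosided pi.
have nilI x : ideal_power I n x -> x = 0.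
  apply: ideal_power_nilpotent (leqnn n) => u Iu.
  by apply: nil_pi => i; apply/eqP; apply: Iu.
have [f0 f0K] := linear_section pi_surj.
(* Normalisation at the unit: 1 - f0 1 lies in I, so adding eps(h) (1 - f0 1) keeps a section and
   gives f 1 = 1. *)
have [f fE] : exists f : {linear H -> E},
    f =1 (fun h => f0 h + (counit h : K) *: (1 - f0 1)).
  by apply: linear_pack; lin.
have fK : cancel f pi.
  move=> h; rewrite fE linearD linearZ /= linearB /= !f0K.
  by rewrite rmorph1 subrr scaler0 addr0.
have f1 : f 1 = 1.
  by rewrite fE (counit1 : counit (1 : H) = 1) scale1r addrC subrK.
have cf a b : ideal_power I 1 (mul_defect f a b).
  by apply: ideal_power1; rewrite /I rmorphB rmorphM /= !fK subrr.
have [s0 s0f] := newton_lift smooth idI nilI (ltn0Sn 0) f1 cf.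
have s0K : cancel s0 pi.
  move=> h; have := ideal_power_sub idI (ltn0Sn 0) (s0f h).
  by rewrite /I rmorphB /= fK => /eqP; rewrite subr_eq0 => /eqP.
have [r [nr [s [sK Ds]]]] : exists r, (n <= r)%N /\
    exists s : {lrmorphism H -> E}, cancel s pi /\
      forall h, tensor_span (ideal_power I r) (colin_defect pi s h).
  (* Positivity of r is carried along: it makes each doubling gain at least one, so n refinements
     reach an exponent at least n. *)
  suff [r [nr [_ Pr]]] : exists r, (n <= r)%N /\ (0 < r)%N /\
    exists s : {lrmorphism H -> E}, cancel s pi /\
      forall h, tensor_span (ideal_power I r) (colin_defect pi s h) by exists r.
  elim: {1}n => [|m [r [mr [r0 [s [sK Ds]]]]]].
    exists 1%N; do 2!split=> //; exists s0; split=> // h.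
    apply: tensor_span_sub (colin_defect_ker pi_hom fK _ s0K) => x.
    exact: ideal_power1.
  exists (r + r)%N; split; first by rewrite -addn1 leq_add.
  by split; [rewrite addn_gt0 r0 | apply: colinear_refinement nilI r0 sK Ds].
exists s; split=> // h; apply/eqP; rewrite -subr_eq0; apply/eqP.
apply: tensor_span_eq0; apply: tensor_span_sub (Ds h) => x.
by move=> /(ideal_power_leq nr)/nilI.
Qed.
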